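(* If there is $\varepsilon > 0$ and an algorithm that, given a graph $G$, an integer $b$, and a set $X \subseteq V(G)$ with $\operatorname{pw}(G - X) \leq 2$, solves \textsc{Vertex Cover} on $(G,b)$ in time $\mathcal{O}^*((2 - \varepsilon)^{|X|})$, then SETH is false.
   Context: \textsc{Vertex Cover}: given an undirected graph $G=(V,E)$ and an integer $b$, decide whether there is $Y\subseteq V$, $|Y|\le b$, such that $G-Y$ has no edges. $\operatorname{pw}$ denotes pathwidth. $\mathcal{O}^*$ suppresses factors polynomial in the input size. SETH: with $c_q = \inf\{\delta : q\text{-SAT (clauses of at most } q \text{ literals) can be solved in time } \mathcal{O}(2^{\delta n})\}$ ($n$ = number of variables), SETH states $\lim_{q\to\infty} c_q = 1$. *)

(* Defs.v *)
From HB Require Import structures.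
From mathcomp Require Import all_boot all_order all_algebra.
From mathcomp Require Import mathcomp_extra boolp classical_sets reals.
From mathcomp Require Import constructive_ereal ereal topology normedtype.
From mathcomp Require Import sequences exp.

Set Implicit Arguments.
Unset Strict Implicit.
Unset Printing Implicit Defensive.

Import Order.TTheory GRing.Theory Num.Theory.
Import numFieldNormedType.Exports.

(* Model of computation: random access machines with logarithmic cost.

  The instruction set is the usual one of the logarithmic-cost RAM (addition,
  truncated subtraction, indirect addressing; no unit-cost arithmetic and no
  multiplication), with structured control flow in place of jumps.  A program
  mentions finitely many registers, so register names incur no cost; memory
  addresses, being computed values, are charged for their length. *)

Inductive expr : Type :=
| Const of nat
| Reg of nat
| Read of expr
| Add of expr & expr
| Sub of expr & expr.

Inductive program : Type :=
| Skip
| Assign of nat & expr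
| Store of expr & expr
| Seq of program & program
| If of expr & program & program
| While of expr & program.

Record state : Type := State { regs : nat -> nat; memory : nat -> nat }.

Definition write_reg (s : state) (r v : nat) : state :=
  State [eta regs s with r |-> v] (memory s).

Definition write_mem (s : state) (a v : nat) : state :=
  State (regs s) [eta memory s with a |-> v].

(* Number of binary digits, with [bitlen 0 = 1]. *)
Definition bitlen (n : nat) : nat := (trunc_log 2 n).+1.

Fixpoint eval_expr (s : state) (e : expr) : nat :=
  match e with
  | Const n => n
  | Reg r => regs s r
  | Read a => memory s (eval_expr s a)
  | Add e1 e2 => eval_expr s e1 + eval_expr s e2
  | Sub e1 e2 => eval_expr s e1 - eval_expr s e2
  end.

(* Every subexpression is charged the length of its value; for [Read a] this
   charges both the address and the content of the cell. *)
Fixpoint cost_expr (s : state) (e : expr) : nat :=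
  bitlen (eval_expr s e) +
  match e with
  | Const _ | Reg _ => 0
  | Read a => cost_expr s a
  | Add e1 e2 | Sub e1 e2 => cost_expr s e1 + cost_expr s e2
  end.

(* [exec p s t s']: started in [s], the program [p] halts in [s'] after time
   [t]; a diverging run has no derivation.  Conditions hold when nonzero. *)
Inductive exec : program -> state -> nat -> state -> Prop :=
| ExecSkip s : exec Skip s 1 s
| ExecAssign r e s :
    exec (Assign r e) s (cost_expr s e).+1
      (write_reg s r (eval_expr s e))
| ExecStore a e s :
    exec (Store a e) s (cost_expr s a + cost_expr s e).+1
      (write_mem s (eval_expr s a) (eval_expr s e))
| ExecSeq p1 p2 s1 t1 s2 t2 s3 :
    exec p1 s1 t1 s2 -> exec p2 s2 t2 s3 -> exec (Seq p1 p2) s1 (t1 + t2) s3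
| ExecIfTrue e p1 p2 s t s' :
    eval_expr s e != 0 -> exec p1 s t s' ->
    exec (If e p1 p2) s (cost_expr s e + t).+1 s'
| ExecIfFalse e p1 p2 s t s' :
    eval_expr s e = 0 -> exec p2 s t s' ->
    exec (If e p1 p2) s (cost_expr s e + t).+1 s'
| ExecWhileTrue e p s1 t1 s2 t2 s3 :
    eval_expr s1 e != 0 -> exec p s1 t1 s2 -> exec (While e p) s2 t2 s3 ->
    exec (While e p) s1 (cost_expr s1 e + t1 + t2).+1 s3
| ExecWhileFalse e p s :
    eval_expr s e = 0 -> exec (While e p) s (cost_expr s e).+1 s.

(* Input words are stored in the memory cells 0, 1, 2, ...; all other cells
   and all registers are initially 0. *)
Definition init (w : seq nat) : state := State (fun=> 0) (nth 0 w).

Definition input_size (w : seq nat) : nat := \sum_(x <- w) bitlen x.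

(* On input [w], [A] halts within time [T] and answers the yes/no question
   [P]; the answer is "yes" when register 0 is nonzero at the end. *)
Definition decides_within (R : realType) (A : program) (w : seq nat)
    (T : R) (P : Prop) : Prop :=
  exists t s', [/\ exec A (init w) t s', (t%:R <= T)%R
                 & (regs s' 0 != 0) <-> P].

Record sgraph (V : finType) : Type := SGraph {
  edge : rel V;
  edge_sym : symmetric edge;
  edge_irr : irreflexive edge
}.

Section Graphs.
Variables (V : finType) (G : sgraph V).

Definition induced_edge (S : {set V}) : rel {x : V | x \in S} :=
  fun x y => edge G (val x) (val y).

Lemma induced_edge_sym (S : {set V}) : symmetric (@induced_edge S).
Proof. by move=> x y; apply: edge_sym. Qed.

Lemma induced_edge_irr (S : {set V}) : irreflexive (@induced_edge S).
Proof. by move=> x; apply: edge_irr. Qed.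

Definition induced (S : {set V}) : sgraph {x : V | x \in S} :=
  SGraph (@induced_edge_sym S) (@induced_edge_irr S).

Definition delete (X : {set V}) : sgraph {x : V | x \in ~: X} :=
  induced (~: X).

Definition edgeless : Prop := forall x y : V, ~~ edge G x y.

Definition path_decomposition (bags : seq {set V}) : Prop :=
  [/\ forall x : V, exists2 B, B \in bags & x \in B,
      forall x y : V, edge G x y ->
        exists2 B, B \in bags & (x \in B) && (y \in B)
    & forall (x : V) (i j k : nat), i <= j <= k ->
        x \in nth finset.set0 bags i -> x \in nth finset.set0 bags k ->
        x \in nth finset.set0 bags j].

(* The truncated predecessor gives the graph without vertices width 0 rather
   than -1. *)
Definition width (bags : seq {set V}) : nat := (\max_(B <- bags) #|B|).-1.

Definition has_path_decomposition_of_width : pred nat :=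
  fun k => `[< exists2 bags, path_decomposition bags & width bags = k >].

Lemma has_path_decomposition : exists k, has_path_decomposition_of_width k.
Proof.
exists (width [:: [set: V]%SET]); apply/asboolP; exists [:: [set: V]%SET] => //.
split=> [x|x y _|x i j k /andP[leij lejk]].
- by exists [set: V]%SET; rewrite ?inE.
- by exists [set: V]%SET; rewrite ?inE.
case: k lejk => [|k] lejk _ /=; last by rewrite nth_nil inE.
by case: j leij lejk => [|//] _ _; rewrite inE.
Qed.

Definition pathwidth : nat := ex_minn has_path_decomposition.

End Graphs.

Definition has_vertex_cover (V : finType) (G : sgraph V) (b : int) : Prop :=
  exists Y : {set V}, (#|Y|%:Z <= b)%R /\ edgeless (delete G Y).

(* Number of vertices, sign and absolute value of the budget, characteristic
   vector of [X], and adjacency matrix of [G] row by row. *)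
Definition encode_VC (n : nat) (G : sgraph 'I_n) (b : int) (X : {set 'I_n}) :
    seq nat :=
  [:: n, nat_of_bool (b < 0)%R, `|b|%N
    & [seq nat_of_bool (i \in X) | i <- enum 'I_n]
      ++ [seq nat_of_bool (edge G i j) | i <- enum 'I_n, j <- enum 'I_n]].

(* Time O*(beta ^ |X|) on the instances (G, b, X) with pw(G - X) <= 2; nothing
   is required of the behaviour on other inputs. *)
Definition solves_VC_pw2_modulator (R : realType) (A : program) (beta : R) :
    Prop :=
  exists c d : nat, forall (n : nat) (G : sgraph 'I_n) (b : int)
      (X : {set 'I_n}),
    pathwidth (delete G X) <= 2 ->
    decides_within A (encode_VC G b X)
      (c%:R * (input_size (encode_VC G b X))%:R ^+ d * beta ^+ #|X|)%R
      (has_vertex_cover G b).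

(* The literal [(x, true)] is the variable [x], and [(x, false)] its negation. *)
Notation literal n := ('I_n * bool)%type.
Notation clause n := (seq (literal n)).

(* A formula is a set of clauses, hence [uniq]: with repeated clauses, no
   running time bound in terms of [n] alone would be possible. *)
Definition is_qCNF (q n : nat) (phi : seq (clause n)) : bool :=
  uniq phi && all (fun C : clause n => size C <= q) phi.

Definition satisfiable (n : nat) (phi : seq (clause n)) : Prop :=
  exists v : 'I_n -> bool,
    all (fun C : clause n => has (fun l : literal n => v l.1 == l.2) C) phi.

Definition encode_literal (n : nat) (l : literal n) : nat :=
  (nat_of_ord l.1).*2 + nat_of_bool l.2.

Definition encode_clause (n : nat) (C : clause n) : seq nat :=
  size C :: map (@encode_literal n) C.

Definition encode_CNF (n : nat) (phi : seq (clause n)) : seq nat :=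
  [:: n, size phi & flatten (map (@encode_clause n) phi)].

Definition qSAT_solvable (R : realType) (q : nat) (delta : R) : Prop :=
  exists (A : program) (c : nat),
    forall (n : nat) (phi : seq (clause n)),
      is_qCNF q phi ->
      decides_within A (encode_CNF phi)
        (c%:R * 2 `^ (delta * n%:R))%R (satisfiable phi).

Local Open Scope classical_set_scope.

Definition sat_exponent (R : realType) (q : nat) : \bar R :=
  ereal_inf [set delta%:E | delta in [set delta : R | qSAT_solvable q delta]].

Definition SETH (R : realType) : Prop :=
  sat_exponent R q @[q --> \oo] --> (1%:E : \bar R).

(* Main.v *)
(* Variables are gathered in groups of [t], and the [2 ^ t] assignments of a
   group are coded by [h]-element subsets of [2 * h] modulator vertices, which
   is possible as soon as [2 ^ t <= 'C(2 * h, h)]; the ratio [2 * h / t] can be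
   made as close to 1 as one likes.  The code words form an antichain, so that
   "this group has this assignment" can be forced by non-adjacency alone.

   A clause becomes a chain of slots [y0, y1, c], one per literal position and
   local assignment, with [y1] adjacent to [y0] and [c], and [y1] and [c]
   adjacent to the next [y0].  An independent set has at most one more vertex
   in a chain than there are slots, and only if it contains some [c]; this [c]
   is adjacent to the modulator vertices outside the code word it stands for.
   Numbering the chains consecutively, adjacent vertices differ by at most 2,
   whence pathwidth at most 2.  The tautologies [v \/ ~ v] are added for all
   variables: if one of them is unsatisfied in a group, then all are, which
   costs [t > h] vertices and cannot be compensated by taking up to [2 * h]
   instead of [h] modulator vertices of that group. *)

Require Import Defs.
From mathcomp Require Import all_boot all_order all_algebra.
From mathcomp Require Import boolp classical_sets reals.
From mathcomp Require Import constructive_ereal ereal topology normedtype.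
From mathcomp Require Import sequences exp.
From mathcomp Require Import zify lra.

Set Implicit Arguments.
Unset Strict Implicit.
Unset Printing Implicit Defensive.

Import Order.TTheory GRing.Theory Num.Theory.

(** * Loop programs and their running time *)

(** Refuting SETH takes one exponent below 1 for all [q]. So [h] and [t], which fix the ratio
    [2 * h / t], are chosen from the base of the algorithm alone; [q] enters only polynomial
    factors, which a slightly larger exponent absorbs. With [h = 2 ^ k], the bound
    [4 ^ h <= (2 * h).+1 * 'C(2 * h, h)] allows [t = 2 * h - (k + 2)], a merely logarithmic loss.
    The extra vertex of a chain is gained where the choice switches from the [y0] to the [y1]: [y0]
    up to some slot, [c] in that slot, [y1] afterwards. One true literal together with its local
    assignment thus pays for a clause. The reduction must be an actual machine program, run before
    the given [A]. Since [A] is specified only on initial states, the program has to end in exactly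
    the state [init] of the encoded instance: work space and registers are erased. The machine has
    neither multiplication nor division, so sizes are computed by counting loops, and adjacency is
    decided by searching through clauses, groups and slots. *)

Inductive cmd : Type :=
| CAssign of nat & expr
| CStore of expr & expr
| CSeq of cmd & cmd
| CIf of expr & cmd & cmd
| CFor of nat & nat & cmd.

(** A loop reads its bound once and decrements its counter before each round, so the body sees the
    values from the bound minus 1 down to 0. Commands therefore always halt, and [sem] can be a
    function. *)
Fixpoint compile (c : cmd) : program :=
  match c with
  | CAssign r e => Assign r e
  | CStore a e => Store a e
  | CSeq c1 c2 => Seq (compile c1) (compile c2)
  | CIf e c1 c2 => If e (compile c1) (compile c2)
  | CFor r b c => Seq (Assign r (Reg b))
      (While (Reg r) (Seq (Assign r (Defs.Sub (Reg r) (Const 1))) (compile c)))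
  end.

Fixpoint sem (c : cmd) (s : state) : state :=
  match c with
  | CAssign r e => write_reg s r (eval_expr s e)
  | CStore a e => write_mem s (eval_expr s a) (eval_expr s e)
  | CSeq c1 c2 => sem c2 (sem c1 s)
  | CIf e c1 c2 => if eval_expr s e != 0 then sem c1 s else sem c2 s
  | CFor r b c =>
      iteri (regs s b) (fun i s' => sem c (write_reg s' r (regs s b - i.+1)))
        (write_reg s r (regs s b))
  end.

Fixpoint writes (c : cmd) : seq nat :=
  match c with
  | CAssign r _ => [:: r]
  | CStore _ _ => [::]
  | CSeq c1 c2 | CIf _ c1 c2 => writes c1 ++ writes c2
  | CFor r _ c => r :: writes c
  end.

(* Loop bounds are read off registers below [k], none of which is ever
   written: this is what makes the running time polynomial. *)
Fixpoint well_formed (k : nat) (c : cmd) : bool :=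
  match c with
  | CAssign r _ => k <= r
  | CStore _ _ => true
  | CSeq c1 c2 | CIf _ c1 c2 => well_formed k c1 && well_formed k c2
  | CFor r b c => [&& k <= r, b < k, r \notin writes c & well_formed k c]
  end.

(** Calibrated for [eval_expr_bound]: on states with [L]-bit contents, an expression has at most
    [L + expr_size e] bits. A constant [n] is below [2 ^ n], and an addition costs one more bit. *)
Fixpoint expr_size (e : expr) : nat :=
  match e with
  | Const n => n.+1
  | Reg _ => 1
  | Read a => (expr_size a).+1
  | Add e1 e2 | Defs.Sub e1 e2 => (expr_size e1 + expr_size e2).+1
  end.

(** A unit-cost time bound when all loop bounds are at most [V]; it also bounds the number of bits
    by which values grow. The added constants are room for the bookkeeping of the loop. *)
Fixpoint weight (V : nat) (c : cmd) : nat :=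
  match c with
  | CAssign _ e => (expr_size e).+1
  | CStore a e => (expr_size a + expr_size e).+1
  | CSeq c1 c2 => weight V c1 + weight V c2
  | CIf e c1 c2 => (expr_size e + weight V c1 + weight V c2).+1
  | CFor _ _ c => V * (weight V c + 7) + 5
  end.

Definition bounded (L : nat) (s : state) : Prop :=
  (forall r, regs s r < 2 ^ L) /\ (forall a, memory s a < 2 ^ L).

Lemma boundedW L L' s : L <= L' -> bounded L s -> bounded L' s.
Proof.
move=> leL [br bm]; have le2 : 2 ^ L <= 2 ^ L' by rewrite leq_exp2l.
by split=> x; [apply: leq_trans (br x) _ | apply: leq_trans (bm x) _].
Qed.

Lemma eval_expr_bound L s e :
  bounded L s -> eval_expr s e < 2 ^ (L + expr_size e).
Proof.
move=> [br bm]; have up x y : x < 2 ^ y -> x < 2 ^ y.+1.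
  by move=> lt; apply: leq_trans lt _; rewrite leq_exp2l.
elim: e => [n|r|a IH|e1 IH1 e2 IH2|e1 IH1 e2 IH2] /=.
- apply: leq_trans (ltn_expl n (isT : 1 < 2)) _.
  by rewrite leq_exp2l // addnS ltnW // ltnS leq_addl.
- by rewrite addn1; apply: up.
- by apply: leq_trans (bm _) _; rewrite leq_exp2l // leq_addr.
- have l1 : 2 ^ (L + expr_size e1) <= 2 ^ (L + (expr_size e1 + expr_size e2)).
    by rewrite leq_exp2l //; lia.
  have l2 : 2 ^ (L + expr_size e2) <= 2 ^ (L + (expr_size e1 + expr_size e2)).
    by rewrite leq_exp2l //; lia.
  by rewrite addnS expnS mul2n -addnn; lia.
- rewrite addnS; apply: up; apply: leq_ltn_trans (leq_subr _ _) _.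
  by apply: leq_trans IH1 _; rewrite leq_exp2l //; lia.
Qed.

Lemma bitlen_bound n k : n < 2 ^ k -> bitlen n <= k.+1.
Proof.
move=> lt; rewrite /bitlen ltnS; case: n lt => [|n] lt; first by rewrite trunc_log0.
rewrite -(@leq_exp2l 2) //; apply: leq_trans (ltnW lt).
exact: trunc_logP.
Qed.

Lemma cost_expr_bound L s e :
  bounded L s -> cost_expr s e <= expr_size e * (L + expr_size e).+1.
Proof.
move=> bs.
elim: e => [n|r|a IH|e1 IH1 e2 IH2|e1 IH1 e2 IH2].
- have := bitlen_bound (eval_expr_bound (Const n) bs); rewrite /=; nia.
- have := bitlen_bound (eval_expr_bound (Reg r) bs); rewrite /=; nia.
- have := bitlen_bound (eval_expr_bound (Read a) bs); rewrite /=; nia.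
- have := bitlen_bound (eval_expr_bound (Add e1 e2) bs); rewrite /=; nia.
- have := bitlen_bound (eval_expr_bound (Defs.Sub e1 e2) bs); rewrite /=; nia.
Qed.

Lemma bounded_write_reg L s r v :
  bounded L s -> v < 2 ^ L -> bounded L (write_reg s r v).
Proof. by move=> [br bm] lt; split=> //= x; case: ifP. Qed.

Lemma bounded_write_mem L s a v :
  bounded L s -> v < 2 ^ L -> bounded L (write_mem s a v).
Proof. by move=> [br bm] lt; split=> //= x; case: ifP. Qed.

Lemma sem_regs c s r : r \notin writes c -> regs (sem c s) r = regs s r.
Proof.
elim: c s => [r' e|a e|c1 IH1 c2 IH2|e c1 IH1 c2 IH2|r' b c IH] s /=.
- by rewrite inE => /negPf ->.
- by [].
- by rewrite mem_cat negb_or => /andP[n1 n2]; rewrite IH2 // IH1.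
- by rewrite mem_cat negb_or => /andP[n1 n2]; case: ifP => _; [apply: IH1|apply: IH2].
- rewrite inE negb_or => /andP[/negPf nr n2].
  by elim: {1}(regs s b) => [|i IHi] /=; rewrite ?IH //= nr.
Qed.

Lemma well_formed_writes k c r : well_formed k c -> r < k -> r \notin writes c.
Proof.
elim: c => [r' e|a e|c1 IH1 c2 IH2|e c1 IH1 c2 IH2|r' b c IH] //=.
- by rewrite inE; lia.
- by move=> /andP[w1 w2] lt; rewrite mem_cat negb_or IH1 ?IH2.
- by move=> /andP[w1 w2] lt; rewrite mem_cat negb_or IH1 ?IH2.
- by move=> /and4P[lek ltb nr w] lt; rewrite inE negb_or IH // andbT; lia.
Qed.

(** The same [w] controls the growth of values and the time, which makes the predicate additive
    under composition. *)
Definition runs (p : program) (s s' : state) (L w : nat) : Prop :=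
  exists t, [/\ exec p s t s', bounded (L + w) s' & t <= 2 * (w * (L + w).+1)].

Lemma runs_seq p1 p2 s1 s2 s3 L w1 w2 :
  runs p1 s1 s2 L w1 -> runs p2 s2 s3 (L + w1) w2 ->
  runs (Seq p1 p2) s1 s3 L (w1 + w2).
Proof.
move=> [t1 [x1 b1 l1]] [t2 [x2 b2 l2]].
exists (t1 + t2); split; first exact: ExecSeq x1 x2.
  by rewrite addnA.
by nia.
Qed.

(* No instruction lengthens the values by more than a constant number of bits,
   hence the logarithmic cost is at most quadratic in the unit cost. *)
Theorem exec_compile k V c s L :
  well_formed k c -> (forall r, r < k -> regs s r <= V) -> bounded L s ->
  runs (compile c) s (sem c s) L (weight V c).
Proof.
elim: c s L => [r e|a e|c1 IH1 c2 IH2|e c1 IH1 c2 IH2|r b c IH] s L /=.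
- move=> _ _ bs; exists (cost_expr s e).+1; split; first exact: ExecAssign.
    apply: bounded_write_reg; first by apply: boundedW bs; lia.
    by apply: leq_trans (eval_expr_bound e bs) _; rewrite leq_exp2l //; lia.
  by have := cost_expr_bound e bs; nia.
- move=> _ _ bs; exists (cost_expr s a + cost_expr s e).+1; split.
  + exact: ExecStore.
  + apply: bounded_write_mem; first by apply: boundedW bs; lia.
    by apply: leq_trans (eval_expr_bound e bs) _; rewrite leq_exp2l //; lia.
  + by have := cost_expr_bound a bs; have := cost_expr_bound e bs; nia.
- move=> /andP[w1 w2] fr bs.
  apply: runs_seq (IH1 _ _ w1 fr bs) (IH2 _ _ w2 _ _).
    by move=> r ltr; rewrite sem_regs ?fr // (well_formed_writes w1).
  by have [t1 []] := IH1 _ _ w1 fr bs.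
- move=> /andP[w1 w2] fr bs.
  have ce := cost_expr_bound e bs.
  case: ifP => [ne0|/negbT]; last rewrite negbK => /eqP e0.
    have [t1 [x1 b1 l1]] := IH1 _ _ w1 fr bs.
    exists (cost_expr s e + t1).+1; split; first exact: ExecIfTrue.
      by apply: boundedW b1; lia.
    by nia.
  have [t1 [x1 b1 l1]] := IH2 _ _ w2 fr bs.
  exists (cost_expr s e + t1).+1; split; first exact: ExecIfFalse.
    by apply: boundedW b1; lia.
  by nia.
move=> /and4P[lekr ltbk nr w] fr bs.
set n := regs s b.
have leV : n <= V by apply: fr.
set W := weight V c in IH *.
pose step i s' := sem c (write_reg s' r (n - i.+1)).
pose st i := iteri i step (write_reg s r n).
have str i : i <= n -> regs (st i) r = n - i.
  case: i => [|i] lei; first by rewrite /= eqxx subn0.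
  by rewrite /st /= /step sem_regs //= eqxx.
have stk i r' : r' < k -> regs (st i) r' = regs s r'.
  move=> ltr; have nrr : (r' == r) = false by apply/negbTE; lia.
  elim: i => [|i IHi] /=; first by rewrite nrr.
  by rewrite /step sem_regs ?(well_formed_writes w) //= nrr.
have bn i L' : i <= n -> bounded L' s -> n - i < 2 ^ L'.
  by move=> _ [br _]; apply: leq_ltn_trans (br b); apply: leq_subr.
(* [j] is the number of rounds still to come. A round may lengthen values by [W] bits in the body
   and by 4 in the decrement, 4 being the [expr_size] of [Sub (Reg r) (Const 1)]. All costs are
   measured at the final length. *)
have loop j : j <= n -> bounded (L + (n - j) * (W + 4)) (st (n - j)) ->
  exists t, [/\ exec (While (Reg r)
      (Seq (Assign r (Defs.Sub (Reg r) (Const 1))) (compile c))) (st (n - j)) t (st n),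
    bounded (L + n * (W + 4)) (st n) &
    t <= 2 * ((j * (W + 7) + 3) * (L + n * (W + 4) + 4).+1)].
  elim: j => [|j IHj] lej.
    rewrite subn0 => bst; exists (cost_expr (st n) (Reg r)).+1; split=> //.
      by apply: ExecWhileFalse; rewrite /= str // subnn.
    by have := cost_expr_bound (Reg r) bst; rewrite /= mul1n; lia.
  set L1 := L + (n - j.+1) * (W + 4) => bst.
  have e1 : n - j = (n - j.+1).+1 by lia.
  have stS : st (n - j) = sem c (write_reg (st (n - j.+1)) r (n - (n - j))).
    by rewrite {1}e1 /st /= /step -e1.
  have rv : regs (st (n - j.+1)) r = j.+1 by rewrite str; lia.
  have bw : bounded (L1 + 4) (write_reg (st (n - j.+1)) r (n - (n - j))).
    apply: bounded_write_reg; first by apply: boundedW bst; lia.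
    by apply: bn; [lia | apply: boundedW bs; rewrite /L1 -addnA leq_addr].
  have frw r' : r' < k -> regs (write_reg (st (n - j.+1)) r (n - (n - j))) r' <= V.
    by move=> lt; rewrite /= stk // ifN ?fr //; lia.
  have [t1 [x1 b1 l1]] := IH _ _ w frw bw.
  have [||t2 [x2 b2 l2]] := IHj; first lia.
    by rewrite stS; apply: boundedW b1; rewrite /L1 e1 mulSn -!addnA leq_add2l; lia.
  have xa := ExecAssign r (Defs.Sub (Reg r) (Const 1)) (st (n - j.+1)).
  have ev : eval_expr (st (n - j.+1)) (Defs.Sub (Reg r) (Const 1)) = n - (n - j).
    by rewrite /= rv; lia.
  rewrite ev in xa.
  have c1 := cost_expr_bound (Reg r) bst.
  have c2 := cost_expr_bound (Defs.Sub (Reg r) (Const 1)) bst.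
  rewrite -stS in x1.
  exists (cost_expr (st (n - j.+1)) (Reg r) +
    ((cost_expr (st (n - j.+1)) (Defs.Sub (Reg r) (Const 1))).+1 + t1) + t2).+1.
  split=> //.
    by apply: ExecWhileTrue (ExecSeq xa x1) x2; rewrite /= rv.
  set B := (L + n * (W + 4) + 4).+1 in l2 *.
  have LB : L1 + 4 + W < B.
    rewrite /B /L1; have : (n - j.+1) * (W + 4) + (W + 4) <= n * (W + 4).
      by rewrite -mulSnr leq_mul2r; lia.
    lia.
  have B1 : 4 < B by rewrite /B; lia.
  clearbody L1 B.
  have l1' : t1 <= 2 * (W * B).
    apply: leq_trans l1 _; rewrite leq_mul2l /= leq_mul2l; apply/orP; right.
    by move: LB; lia.
  have c1' : cost_expr (st (n - j.+1)) (Reg r) <= B.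
    by apply: leq_trans c1 _; rewrite /= mul1n; lia.
  have c2' : cost_expr (st (n - j.+1)) (Defs.Sub (Reg r) (Const 1)) <= 4 * B.
    by apply: leq_trans c2 _; rewrite /= leq_mul2l; lia.
  rewrite mulSn -[_ + j * _ + 3]addnA (mulnDl (W + 7)) (mulnDl W).
  by move: (_ * B) l2 (W * B) l1' => Z l2 Y l1'; lia.
have [//||t [x b' l]] := loop n.
  rewrite subnn mul0n addn0; apply: bounded_write_reg => //.
  by rewrite -(subn0 n); apply: bn.
rewrite subnn in x.
have ce : cost_expr s (Reg b) <= (L + 1).+1.
  by rewrite -[X in _ <= X]mul1n; apply: cost_expr_bound (Reg b) bs.
exists ((cost_expr s (Reg b)).+1 + t); split.
- by apply: ExecSeq x; apply: ExecAssign.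
- by apply: boundedW b'; rewrite leq_add2l (leq_trans _ (leq_addr _ _)) // leq_mul //; lia.
have h2 : n * (W + 7) <= V * (W + 7) by rewrite leq_mul2r leV orbT.
have h1 : n * (W + 4) <= V * (W + 7) by apply: leq_mul; lia.
set B := (L + _).+1; have leB : (L + n * (W + 4) + 4).+1 <= B by rewrite /B; lia.
have leB' : (L + 1).+1 <= B by rewrite /B; lia.
have l' : t <= 2 * ((V * (W + 7) + 3) * B).
  by apply: leq_trans l _; rewrite leq_mul2l leq_mul //; lia.
clearbody B; move: l'; rewrite !(mulnDl (V * (W + 7))).
by move: (V * (W + 7) * B) => x3; lia.
Qed.

Lemma weight_poly c : exists a d, forall V, weight V c <= a * V.+1 ^ d.
Proof.
elim: c => [r e|a e|c1 [a1 [d1 H1]] c2 [a2 [d2 H2]]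
           |e c1 [a1 [d1 H1]] c2 [a2 [d2 H2]]|r b c [a [d H]]] /=.
- by exists (expr_size e).+1, 0 => V; rewrite muln1.
- by exists (expr_size a + expr_size e).+1, 0 => V; rewrite muln1.
- exists (a1 + a2), (d1 + d2) => V.
  rewrite mulnDl leq_add //; [apply: leq_trans (H1 V) _|apply: leq_trans (H2 V) _];
    by rewrite leq_mul2l leq_pexp2l ?orbT //; lia.
- exists (expr_size e + a1 + a2).+1, (d1 + d2) => V.
  have g1 : weight V c1 <= a1 * V.+1 ^ (d1 + d2).
    by apply: leq_trans (H1 V) _; rewrite leq_mul2l leq_pexp2l ?orbT //; lia.
  have g2 : weight V c2 <= a2 * V.+1 ^ (d1 + d2).
    by apply: leq_trans (H2 V) _; rewrite leq_mul2l leq_pexp2l ?orbT //; lia.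
  have : 0 < V.+1 ^ (d1 + d2) by rewrite expn_gt0.
  by move: (V.+1 ^ _) g1 g2 => y; nia.
- exists (a + 12), d.+1 => V; have := H V; rewrite expnS.
  have : 0 < V.+1 ^ d by rewrite expn_gt0.
  move: (V.+1 ^ d) (weight V c) => y w; nia.
Qed.

(** The counter descends, so [Inv v] describes the state after the rounds for all counter values at
    least [v]. *)
Lemma sem_for r b c s (Inv : nat -> state -> Prop) :
  Inv (regs s b) (write_reg s r (regs s b)) ->
  (forall v s', v < regs s b -> Inv v.+1 s' -> Inv v (sem c (write_reg s' r v))) ->
  Inv 0 (sem (CFor r b c) s).
Proof.
set n := regs s b => I0 IS /=.
suff H i : i <= n -> Inv (n - i)
   (iteri i (fun j s' => sem c (write_reg s' r (n - j.+1))) (write_reg s r n)).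
  by have := H n (leqnn n); rewrite subnn.
elim: i => [|i IH] lti /=; first by rewrite subn0.
apply: IS; first lia.
by rewrite subnSK //; apply: IH; apply: ltnW.
Qed.

Lemma exec_time_gt0 p s t s' : exec p s t s' -> 0 < t.
Proof. by elim=> // *; lia. Qed.

(** * The graph of a formula *)

Lemma sum_nat_mul a b (F : nat -> nat) :
  \sum_(0 <= w < a * b) F w = \sum_(0 <= j < b) \sum_(0 <= i < a) F (a * j + i).
Proof.
elim: b => [|b IH]; first by rewrite muln0 !big_geq.
rewrite big_nat_recr //= -IH mulnSr (@big_cat_nat _ _ _ (a * b)) ?leq_addr //=.
congr addn; rewrite -{1}[a * b]add0n big_addn addKn.
by apply: eq_bigr => i _; rewrite addnC.
Qed.

Lemma leq_const_sum n c (F : nat -> nat) :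
  (forall i, i < n -> c <= F i) -> c * n <= \sum_(0 <= i < n) F i.
Proof.
elim: n => [|n IH] le; first by rewrite muln0.
rewrite big_nat_recr //= mulnSr leq_add ?le ?IH // => i lti.
by apply: le; apply: ltnW.
Qed.

Lemma leq_sum_const n c (F : nat -> nat) :
  (forall i, i < n -> F i <= c) -> \sum_(0 <= i < n) F i <= c * n.
Proof.
elim: n => [|n IH] le; first by rewrite big_geq.
rewrite big_nat_recr //= mulnSr leq_add ?le ?IH // => i lti.
by apply: le; apply: ltnW.
Qed.

(** This will identify a group with a code word: its chosen vertices lie inside the code word and
    are as numerous. *)
Lemma sum_bool_sub n (P R : nat -> bool) :
  (forall e, e < n -> P e -> R e) ->
  \sum_(0 <= e < n) R e <= \sum_(0 <= e < n) P e ->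
  forall e, e < n -> P e = R e.
Proof.
elim: n => [//|n IH] sub; rewrite !big_nat_recr //= => le e.
have le' : \sum_(0 <= e < n) P e <= \sum_(0 <= e < n) R e.
  by rewrite !big_nat; apply: leq_sum => i lti; case: (P i) (sub i) => // ->; lia.
have subn : P n -> R n by apply: sub.
have PR : P n = R n by case: (P n) (R n) subn le => [] [] // => [/(_ isT)|] //; lia.
rewrite ltnS leq_eqVlt => /orP[/eqP -> //|]; apply: IH.
  by move=> i lti; apply: sub; apply: ltnW.
by rewrite PR leq_add2r in le.
Qed.

(** Tightness of a total passes to each summand; [defect_zero] applies this to the groups. *)
Lemma sum_nat_le_eq n (F H : nat -> nat) :
  (forall i, i < n -> F i <= H i) ->
  \sum_(0 <= i < n) H i <= \sum_(0 <= i < n) F i ->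
  forall i, i < n -> F i = H i.
Proof.
elim: n => [//|n IH] sub; rewrite !big_nat_recr //= => le i.
have le' : \sum_(0 <= e < n) F e <= \sum_(0 <= e < n) H e.
  by rewrite !big_nat; apply: leq_sum => e lte; apply: sub; lia.
have subn := sub n (ltnSn n).
rewrite ltnS leq_eqVlt => /orP[/eqP -> |]; first lia.
apply: IH; last lia.
by move=> e lte; apply: sub; apply: ltnW.
Qed.

Lemma sum_bool_card n (P : 'I_n -> bool) : \sum_(i < n) P i = #|[set i | P i]|.
Proof.
rewrite -sum1_card big_mkcond [RHS]big_mkcond; apply: eq_bigr => i _.
by rewrite inE; case: (P i).
Qed.

(** Pathwidth is at most bandwidth: the bags are windows of three consecutive labels, and
    injectivity leaves at most three vertices in each. *)
Lemma pathwidth_le2 (V : finType) (G : sgraph V) (f : V -> nat) :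
  injective f -> (forall x y, edge G x y -> f x <= f y + 2) -> pathwidth G <= 2.
Proof.
move=> injf near.
pose K := (\max_x f x).+1.
have ltK x : f x < K by rewrite ltnS; apply: leq_bigmax.
clearbody K.
pose B w := [set x | w <= f x <= w + 2].
pose bags := [seq B w | w <- iota 0 K].
(* This also holds past the last bag, where [nth] returns the empty set and no label is as large as
   [i]; the interval condition becomes pure arithmetic. *)
have nthB i x : (x \in nth finset.set0 bags i) = (i <= f x <= i + 2).
  have [ltiK|leKi] := ltnP i K.
    by rewrite (nth_map 0) ?size_iota // nth_iota // inE.
  rewrite nth_default ?size_map ?size_iota // inE; apply/esym/negbTE.
  by have := ltK x; lia.
have memB x : B (f x) \in bags.
  by apply: map_f; rewrite mem_iota /= add0n.
have pd : path_decomposition G bags.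
  split=> [x|x y exy|x i j k /andP[leij lejk]].
  - by exists (B (f x)); rewrite // inE; lia.
  - have := near _ _ exy; rewrite (edge_sym G) in exy; have := near _ _ exy.
    case: (leqP (f x) (f y)) => l0 l1 l2.
      by exists (B (f x)); rewrite // !inE; lia.
    by exists (B (f y)); rewrite // !inE; lia.
  - by rewrite !nthB; lia.
have wd : width bags <= 2.
  rewrite /width -subn1 leq_subLR; apply/bigmax_leqP_seq => b /mapP[w _ ->] _.
  have -> : #|B w| = size [seq f x | x in B w] by rewrite size_image.
  have -> : 1 + 2 = size [:: w; w.+1; w.+2] by [].
  apply: uniq_leq_size; first by rewrite map_inj_uniq ?enum_uniq.
  by move=> u /fintype.imageP[x]; rewrite !inE => ? ->; lia.
rewrite /pathwidth; case: ex_minnP => k _ /(_ (width bags)) le.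
by apply: leq_trans wd; apply: le; apply/asboolP; exists bags.
Qed.

Section Reduction.

(* Clauses [j < m] are those of the formula, and clause [m + v] is the
   tautology on the variable [v].  [lit j k] is 0 if clause [j] has no literal
   at position [k < Q], and [1 + 2 * v + s] if it has the literal of variable
   [v] and sign [s] there.  Variable [t * gr + r] is number [r] of the group
   [gr < g]; a local assignment [a < A] gives it the value [bit a r], and
   [code a] is the code word of [a].  Slot [i < Q * A] of a clause stands for
   the position [i %/ A] and the local assignment [i %% A]. *)
Variables (h t Q A : nat) (bit code : nat -> nat -> bool).
Variables (g m : nat) (lit : nat -> nat -> nat).

Let N := Q * A.
Definition num_clauses := m + t * g.
Definition num_modulator := 2 * h * g.
Definition num_vertices := num_modulator + 3 * (N * num_clauses).
Definition slot j i := num_modulator + 3 * (N * j + i).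

(** An empty position conflicts with everything, and a local assignment falsifying the literal
    conflicts with the whole group of its variable; an independent set of full size meets every
    group, which excludes both. Otherwise only vertices outside the code word conflict. Bounded
    searches replace division, so that [conflict_expr] can copy the definition. *)
Definition conflict a l x gr :=
  (l == 0) || has (fun r => has (fun s : bool => has (fun e =>
    [&& l == 1 + 2 * (t * gr + r) + s, x == 2 * h * gr + e &
        (bit a r != s) || ~~ code a e]) (iota 0 (2 * h))) [:: true; false])
    (iota 0 t).

Definition arc_at u v j gr i :=
  [|| (v == slot j i + 1) && ((u == slot j i) || (u == slot j i + 2)),
      [&& i.+1 < N, v == slot j i + 3 & (u == slot j i + 1) || (u == slot j i + 2)]
    | [&& u == slot j i + 2, v < num_modulator & conflict (i %% A) (lit j (i %/ A)) v gr]].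

Definition arc u v :=
  has (fun j => has (fun gr => has (arc_at u v j gr) (iota 0 N)) (iota 0 g))
    (iota 0 num_clauses).

Definition adj u v := arc u v || arc v u.

Definition satisfied (f : nat -> bool) j :=
  has (fun k => (lit j k != 0) && (f (lit j k).-1./2 == odd (lit j k).-1)) (iota 0 Q).

Definition target := h * g + N.+1 * num_clauses.

Definition independent (P : nat -> bool) :=
  forall u v, u < num_vertices -> v < num_vertices -> P u -> P v -> ~~ adj u v.

Lemma arcP u v : reflect (exists j gr i,
    [/\ j < num_clauses, gr < g, i < N & arc_at u v j gr i]) (arc u v).
Proof.
apply: (iffP hasP) => [[j jin /hasP[gr grin /hasP[i iin H]]]|[j [gr [i [jin grin iin H]]]]].
  by move: jin grin iin; rewrite !mem_iota /= => ? ? ?; exists j, gr, i.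
exists j; first by rewrite mem_iota.
apply/hasP; exists gr; first by rewrite mem_iota.
by apply/hasP; exists i; rewrite ?mem_iota.
Qed.

Lemma adj_sym : symmetric adj.
Proof. by move=> u v; rewrite /adj orbC. Qed.

Lemma adj_irr : irreflexive adj.
Proof.
move=> u; rewrite /adj orbb; apply/negP => /arcP[j [gr [i [_ _ _]]]].
by rewrite /arc_at /slot; case/or3P; lia.
Qed.

Lemma adj_near u v :
  num_modulator <= u -> num_modulator <= v -> adj u v -> u <= v + 2.
Proof.
move=> leu lev /orP[] /arcP[j [gr [i [_ _ _]]]];
  by rewrite /arc_at /slot; case/or3P; lia.
Qed.

Lemma slot_lt j i : j < num_clauses -> i < N -> slot j i + 3 <= num_vertices.
Proof.
move=> ltj lti; rewrite /slot /num_vertices -addnA leq_add2l.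
have : N * j.+1 <= N * num_clauses by rewrite leq_mul2l ltj orbT.
rewrite mulnS; lia.
Qed.

Lemma slotS j i : slot j i.+1 = slot j i + 3.
Proof. by rewrite /slot; lia. Qed.

Definition graph : sgraph 'I_num_vertices :=
  @SGraph 'I_num_vertices (fun x y => adj x y) (fun x y => adj_sym x y)
    (fun x => adj_irr x).

Definition modulator : {set 'I_num_vertices} := 
  [set x : 'I_num_vertices | x < num_modulator].

(** This is [num_vertices - target], vertex covers being the complements of independent sets; in
    this form the program can evaluate it. *)
Definition budget := h * g + (2 * N - 1) * num_clauses.

Lemma card_modulator : #|modulator| = num_modulator.
Proof.
rewrite -sum1_card (eq_bigl (fun x : 'I_num_vertices => x < num_modulator)); last first.
  by move=> x; rewrite inE.
rewrite -(big_mkord (fun i => i < num_modulator) (fun=> 1)) /num_vertices.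
rewrite (@big_cat_nat _ _ _ num_modulator) ?leq_addr //=.
rewrite [X in _ + X]big_nat_cond [X in _ + X]big1 ?addn0; last first.
  by move=> i /andP[/andP[H1 _] H2]; lia.
rewrite big_nat_cond (eq_bigl (fun i => 0 <= i < num_modulator)); last first.
  by move=> i; rewrite andbb.
by rewrite -big_nat sum_nat_const_nat subn0 muln1.
Qed.

Lemma pathwidth_graph : pathwidth (delete graph modulator) <= 2.
Proof.
apply: (@pathwidth_le2 _ _ (fun x => val (val x))).
  by move=> x y /val_inj /val_inj.
move=> [x xin] [y yin] /=; rewrite /induced_edge /=.
by move: xin yin; rewrite !inE -!leqNgt; apply: adj_near.
Qed.

Hypothesis g_gt0 : 0 < g.

Lemma arc_conflict j gr i x : j < num_clauses -> gr < g -> i < N ->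
  x < num_modulator -> conflict (i %% A) (lit j (i %/ A)) x gr ->
  adj (slot j i + 2) x.
Proof.
move=> ltj ltgr lti ltx cf; apply/orP; left; apply/arcP; exists j, gr, i.
by split=> //; rewrite /arc_at eqxx ltx cf /= !orbT.
Qed.

(** * Independent sets in a clause chain *)

Section Gadget.

Variables (P : nat -> bool) (j : nat).
Hypotheses (indP : independent P) (ltj : j < num_clauses).

Definition slot_count (P : nat -> bool) j i := \sum_(0 <= r < 3) P (slot j i + r).

Lemma slot_countE i :
  slot_count P j i = P (slot j i) + P (slot j i + 1) + P (slot j i + 2).
Proof. by rewrite /slot_count !big_nat_recr //= big_geq // addn0. Qed.

Lemma slot_indep i : i < N ->
  [/\ ~~ (P (slot j i) && P (slot j i + 1)),
      ~~ (P (slot j i + 2) && P (slot j i + 1)) &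
      i.+1 < N -> ~~ (P (slot j i + 1) && P (slot j i.+1)) &&
                  ~~ (P (slot j i + 2) && P (slot j i.+1))].
Proof.
move=> lti; have lts := slot_lt ltj lti.
have H u v : u < num_vertices -> v < num_vertices -> arc_at u v j 0 i ->
  ~~ (P u && P v).
  move=> ltu ltv auv; apply/negP => /andP[pu pv].
  move/negP: (indP ltu ltv pu pv); apply; apply/orP; left.
  (* Arcs within a chain are the same for every group; group 0 exists by [g_gt0]. *)
  by apply/arcP; exists j, 0, i.
split.
- by apply: H; [lia|lia|rewrite /arc_at !eqxx].
- by apply: H; [lia|lia|rewrite /arc_at !eqxx orbT].
- move=> lti1; have lts1 := slot_lt ltj lti1; rewrite slotS in lts1 *.
  by apply/andP; split; (apply: H; [lia|lia|rewrite /arc_at lti1 !eqxx /= ?orbT //]).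
Qed.

(* The excess of a slot over one chosen vertex is paid for by [y0] of the next
   slot being free, so that the excesses telescope. *)
Lemma gadget_count_le : \sum_(0 <= i < N) slot_count P j i <= N.+1.
Proof.
(* There is no slot after the last one, so [z N] is false and the telescoping leaves only [z 0],
   which is at most 1. *)
pose z i := (i < N) && P (slot j i).
suff H k : k <= N -> \sum_(0 <= i < k) slot_count P j i + z k <= k + z 0.
  by have := H N (leqnn N); case: (z 0); case: (z N); lia.
elim: k => [|k IH] ltk; first by rewrite big_geq.
rewrite big_nat_recr //= slot_countE; have := IH (ltnW ltk).
have zk : z k = P (slot j k) by rewrite /z ltk.
have [] := slot_indep ltk; rewrite zk /z; case: (ltnP k.+1 N) => [_|_].
  move=> + + /(_ isT).
  by case: (P (slot j k)) (P (slot j k + 1)) (P (slot j k + 2)) (P (slot j k.+1))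
     => [] [] [] [] //=; lia.
move=> + + _.
by case: (P (slot j k)) (P (slot j k + 1)) (P (slot j k + 2)) => [] [] [] //=; lia.
Qed.

(** Without any [c], a slot contributes at most one of the adjacent vertices [y0] and [y1]. *)
Lemma gadget_full : N < \sum_(0 <= i < N) slot_count P j i ->
  exists2 i, i < N & P (slot j i + 2).
Proof.
move=> gt; apply/exists2P/not_existsP => none.
suff : \sum_(0 <= i < N) slot_count P j i <= N by lia.
rewrite -[leqRHS]mul1n; apply: leq_sum_const => i lti; rewrite slot_countE.
have [+ _ _] := slot_indep lti; case p2: (P (slot j i + 2)).
  by case: (none i).
by case: (P (slot j i)) (P (slot j i + 1)) => [] [].
Qed.

End Gadget.

Lemma sum_vertices (P : nat -> bool) :
  \sum_(0 <= u < num_vertices) P u =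
  \sum_(0 <= gr < g) \sum_(0 <= e < 2 * h) P (2 * h * gr + e) +
  \sum_(0 <= j < num_clauses) \sum_(0 <= i < N) slot_count P j i.
Proof.
rewrite (@big_cat_nat _ _ _ num_modulator) ?leq_addr //=.
congr addn; first exact: (sum_nat_mul (2 * h) g).
rewrite -{1}[num_modulator]add0n big_addn addKn sum_nat_mul.
rewrite sum_nat_mul; apply: eq_bigr => j _; apply: eq_bigr => i _.
by apply: eq_bigr => r _; congr (nat_of_bool (P _)); rewrite /slot; lia.
Qed.

Hypotheses (h_gt0 : 0 < h) (h_lt_t : h < t) (Q_gt1 : 1 < Q) .
Hypothesis bit_surj : forall f : nat -> bool,
  exists2 a, a < A & forall r, r < t -> bit a r = f r.
Hypothesis code_weight : forall a, a < A -> \sum_(0 <= e < 2 * h) code a e = h.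
Hypothesis code_inj : forall a a', a < A -> a' < A ->
  (forall e, e < 2 * h -> code a e = code a' e) ->
  forall r, r < t -> bit a r = bit a' r.
Hypothesis lit_var : forall j k, j < num_clauses -> k < Q -> lit j k != 0 ->
  (lit j k).-1./2 < t * g.
Hypothesis lit_taut : forall v, v < t * g ->
  lit (m + v) 0 = 2 * v + 2 /\ forall k, 0 < k -> 
  lit (m + v) k = if k == 1 then 2 * v + 1 else 0.

Lemma A_gt0 : 0 < A.
Proof. by have [a lta _] := bit_surj (fun=> true); apply: leq_ltn_trans lta. Qed.

Lemma t_gt0 : 0 < t. Proof. exact: leq_ltn_trans h_lt_t. Qed.

Lemma N_gt0 : 0 < N. Proof. by rewrite muln_gt0 A_gt0 andbT; lia. Qed.

(** For a literal in range, division by [t] yields the group and the number within it that the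
    searches of [conflict] look for. *)
Lemma conflictP a l x gr : l != 0 -> (l.-1)./2 < t * g -> 
  reflect [/\ gr = (l.-1)./2 %/ t, 2 * h * gr <= x < 2 * h * gr.+1 &
    (bit a ((l.-1)./2 %% t) != odd l.-1) || ~~ code a (x - 2 * h * gr)]
  (conflict a l x gr).
Proof.
move=> l0 ltv; rewrite /conflict (negPf l0) orFb.
apply: (iffP idP) => [/hasP[r]|[-> /andP[lex ltx] H]].
  rewrite mem_iota add0n => /andP[_ ltr] /hasP[s _ /hasP[e]].
  rewrite mem_iota /= => lte /and3P[/eqP El /eqP -> H].
  have E1 : l.-1 = s + (t * gr + r).*2 by rewrite El -mul2n; lia.
  have -> : (l.-1)./2 = gr * t + r by rewrite E1 half_bit_double mulnC.
  rewrite divnMDl ?t_gt0 // divn_small // addn0 modnMDl modn_small //.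
  split=> //; first by rewrite leq_addr mulnS addnC ltn_add2r.
  by rewrite E1 oddD odd_double addbF addKn oddb.
set v := (l.-1)./2 in ltv lex ltx H *.
apply/hasP; exists (v %% t); first by rewrite mem_iota /= ltn_mod t_gt0.
apply/hasP; exists (odd l.-1); first by case: (odd _).
apply/hasP; exists (x - 2 * h * (v %/ t)).
  by rewrite mem_iota /= add0n ltn_subLR // -mulnSr.
rewrite H andbT; apply/andP; split; last by rewrite subnKC.
have -> : t * (v %/ t) + v %% t = v by rewrite mulnC -divn_eq.
by have := odd_double_half l.-1; rewrite -/v -mul2n; lia.
Qed.

(** * From a satisfying assignment to an independent set *)

Section Completeness.

Variable f : nat -> bool.
Hypothesis f_sat : forall j, j < m -> satisfied f j.

Let local gr := find (fun a => all (fun r => bit a r == f (t * gr + r)) (iota 0 t)) (iota 0 A).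

Lemma localP gr : local gr < A /\ forall r, r < t -> bit (local gr) r = f (t * gr + r).
Proof.
have [a lta abit] := bit_surj (fun r => f (t * gr + r)).
have H : has (fun a => all (fun r => bit a r == f (t * gr + r)) (iota 0 t)) (iota 0 A).
  apply/hasP; exists a; first by rewrite mem_iota.
  by apply/allP => r; rewrite mem_iota /= => ltr; rewrite abit.
have := nth_find 0 H; rewrite -/(local gr).
move: H; rewrite has_find size_iota -/(local gr) => lt; rewrite nth_iota // add0n.
by move=> /allP H; split=> // r ltr; apply/eqP; apply: H; rewrite mem_iota.
Qed.

Let available j i :=
  [&& lit j (i %/ A) != 0, f (lit j (i %/ A)).-1./2 == odd (lit j (i %/ A)).-1 &
      i %% A == local ((lit j (i %/ A)).-1./2 %/ t)].

Let pick_slot j := find (available j) (iota 0 N).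

Lemma pick_slotP j : j < num_clauses -> pick_slot j < N /\ available j (pick_slot j).
Proof.
move=> ltj.
(* Any [f] satisfies the tautologies: position 0 holds the positive literal, coded [2 * v + 2], and
   position 1 the negative one, coded [2 * v + 1]. Both positions exist by [Q_gt1]. *)
have sat : satisfied f j.
  have [/f_sat //|lemj] := ltnP j m.
  have ltv : j - m < t * g by move: ltj; rewrite /num_clauses; lia.
  have [l0 l1] := lit_taut ltv; rewrite subnKC // in l0 l1.
  apply/hasP; case Ef : (f (j - m)).
    exists 0; first by rewrite mem_iota; lia.
    rewrite l0 addn2 /= mul2n uphalf_double Ef odd_double //.
  exists 1; first by rewrite mem_iota; lia.
  rewrite l1 // addn1 /= mul2n doubleK Ef odd_double //.
have H : has (available j) (iota 0 N).
  have /hasP[k] := sat; rewrite mem_iota /= add0n => ltk /andP[l0 fl].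
  set a := local ((lit j k).-1./2 %/ t).
  have [lta _] := localP ((lit j k).-1./2 %/ t); rewrite -/a in lta.
  apply/hasP; exists (k * A + a).
    rewrite mem_iota /= add0n /N.
    have : k.+1 * A <= Q * A by rewrite leq_mul2r ltk orbT.
    by rewrite mulSn; lia.
  rewrite /available divnMDl ?A_gt0 // (divn_small lta) addn0 modnMDl modn_small //.
  by rewrite l0 fl eqxx.
have := nth_find 0 H; rewrite -/(pick_slot j).
by move: H; rewrite has_find size_iota -/(pick_slot j) => lt; rewrite nth_iota // add0n.
Qed.

(** In each chain, [y0] is taken up to and including the picked slot, [c] in that slot, and [y1]
    after it: one vertex per slot, two in the picked one. *)
Definition solution u :=
  if u < num_modulator then code (local (u %/ (2 * h))) (u %% (2 * h))
  else let w := u - num_modulator in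
    let j := w %/ 3 %/ N in let i := (w %/ 3) %% N in
    if w %% 3 == 0 then i <= pick_slot j
    else if w %% 3 == 1 then pick_slot j < i else i == pick_slot j.

Lemma solution_slot j i r : i < N -> r < 3 -> solution (slot j i + r) =
  if r == 0 then i <= pick_slot j
  else if r == 1 then pick_slot j < i else i == pick_slot j.
Proof.
move=> lti ltr; rewrite /solution /slot -addnA ltnNge leq_addr /= addKn.
rewrite mulnC divnMDl // (divn_small ltr) addn0 modnMDl (modn_small ltr).
by rewrite mulnC divnMDl ?N_gt0 // (divn_small lti) addn0 modnMDl (modn_small lti).
Qed.

Lemma solution_modulator gr e : gr < g -> e < 2 * h ->
  solution (2 * h * gr + e) = code (local gr) e.
Proof.
move=> ltgr lte; rewrite /solution.
have -> : 2 * h * gr + e < num_modulator.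
  have : 2 * h * gr.+1 <= 2 * h * g by rewrite leq_mul2l ltgr orbT.
  by rewrite /num_modulator mulnS; lia.
rewrite [2 * h * gr]mulnC divnMDl; last lia.
by rewrite (divn_small lte) addn0 modnMDl (modn_small lte).
Qed.

Lemma solution_indep : independent solution.
Proof.
suff H u v : arc u v -> solution u -> solution v -> False.
  move=> u v _ _ su sv; apply/negP => /orP[] auv; first exact: H auv su sv.
  exact: H auv sv su.
move=> /arcP[j [gr [i [ltj ltgr lti]]]]; rewrite /arc_at.
have [ltc /and3P[l0 fl ei]] := pick_slotP ltj.
have S0 := @solution_slot j i 0 lti isT; rewrite addn0 /= in S0.
have S1 := @solution_slot j i 1 lti isT; rewrite /= in S1.
have S2 := @solution_slot j i 2 lti isT; rewrite /= in S2.
case/or3P.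
- by move=> /andP[/eqP -> /orP[] /eqP ->]; rewrite S1 ?S0 ?S2; lia.
- move=> /and3P[lti1 /eqP -> /orP[] /eqP ->];
  have S3 := @solution_slot j i.+1 0 lti1 isT; rewrite addn0 slotS /= in S3;
  by rewrite S3 ?S1 ?S2; lia.
(* The picked slot carries the local assignment induced by [f] on its group, which satisfies the
   literal. A conflict is then only possible with vertices outside the code word, and these are not
   in the solution. *)
- move=> /and3P[/eqP -> ltv cf]; rewrite S2 => /eqP Ei.
  move: cf; rewrite Ei => cf.
  have ltk : pick_slot j %/ A < Q by rewrite ltn_divLR ?A_gt0.
  have ltl := lit_var ltj ltk l0.
  case/(conflictP _ _ _ l0 ltl): cf => Egr /andP[lev ltv'].
  rewrite (eqP ei) -Egr.
  have [_ lb] := localP gr.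
  rewrite lb ?ltn_mod ?t_gt0 //.
  rewrite {1}Egr [t * _]mulnC -divn_eq (eqP fl) eqxx /=.
  have lte : v - 2 * h * gr < 2 * h by rewrite ltn_subLR // -mulnSr.
  rewrite -(solution_modulator ltgr lte) subnKC // => /negP; apply.
Qed.

Lemma solution_count : target <= \sum_(0 <= u < num_vertices) solution u.
Proof.
rewrite sum_vertices /target; apply: leq_add.
  apply: leq_const_sum => gr ltgr.
  have [lta _] := localP gr.
  rewrite -[leqLHS](code_weight lta) !big_nat; apply: leq_sum => e lte.
  by rewrite solution_modulator.
apply: leq_const_sum => j ltj.
have [ltc _] := pick_slotP ltj.
have E i : i < N -> slot_count solution j i = (i == pick_slot j).+1.
  move=> lti; rewrite slot_countE.
  rewrite -{1}[slot j i]addn0 !solution_slot //=.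
  by case: (ltngtP i (pick_slot j)).
rewrite big_nat (eq_bigr _ E) -big_nat.
rewrite (eq_bigr (fun i => 1 + (i == pick_slot j))) // big_split /=.
rewrite sum_nat_const_nat subn0 muln1 -addn1 leq_add2l.
by rewrite (bigD1_seq (pick_slot j)) ?iota_uniq ?mem_index_iota //= eqxx.
Qed.

End Completeness.

(** * From a large independent set to a satisfying assignment *)

Section Soundness.

Variable P : nat -> bool.
Hypotheses (indP : independent P)
  (sizeP : target <= \sum_(0 <= u < num_vertices) P u).

Let S gr := \sum_(0 <= e < 2 * h) P (2 * h * gr + e).
Let D j := \sum_(0 <= i < N) slot_count P j i.
(** The defect of a chain, that is, what it lacks from its maximum; by [gadget_count_le] the
    subtraction does not truncate. *)
Let U j := N.+1 - D j.

Lemma modulator_lt gr e : gr < g -> e < 2 * h -> 2 * h * gr + e < num_modulator.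
Proof.
move=> ltgr lte.
have : 2 * h * gr.+1 <= 2 * h * g by rewrite leq_mul2l ltgr orbT.
by rewrite /num_modulator mulnS; lia.
Qed.

(** A [c] whose local assignment falsifies its literal merely blocks the group of that literal. The
    truth of the literal is therefore only obtained from a chosen vertex in the group, later
    supplied by [group_nonempty]. *)
Lemma chosen_option j i : j < num_clauses -> i < N -> P (slot j i + 2) ->
  let l := lit j (i %/ A) in
  if l == 0 then forall gr e, gr < g -> e < 2 * h -> ~~ P (2 * h * gr + e)
  else forall e, e < 2 * h -> P (2 * h * (l.-1./2 %/ t) + e) ->
    (bit (i %% A) (l.-1./2 %% t) == odd l.-1) && code (i %% A) e.
Proof.
move=> ltj lti Pc l.
have lts := slot_lt ltj lti.
have no x gr : x < num_modulator -> gr < g -> P x -> ~~ conflict (i %% A) l x gr.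
  move=> ltx ltgr Px; apply/negP => cf.
  have := arc_conflict ltj ltgr lti ltx cf; apply/negP; apply: indP => //; first lia.
  by apply: leq_trans ltx _; rewrite leq_addr.
have [l0|l0] := eqVneq l 0.
  move=> gr e ltgr lte; apply/negP => Px.
  by have := no _ _ (modulator_lt ltgr lte) ltgr Px; rewrite l0.
have ltk : i %/ A < Q by rewrite ltn_divLR ?A_gt0.
have ltl := lit_var ltj ltk l0; rewrite -/l in ltl.
have ltgr : l.-1./2 %/ t < g by rewrite ltn_divLR ?t_gt0 // mulnC.
move=> e lte Px.
have := no _ _ (modulator_lt ltgr lte) ltgr Px.
apply: contraR => H; apply/(conflictP _ _ _ l0 ltl); split=> //.
  by rewrite leq_addr mulnS addnC ltn_add2r.
by rewrite addKn -negb_and.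
Qed.

Lemma defect_add j : j < num_clauses -> D j + U j = N.+1.
Proof. by move=> ltj; rewrite subnKC // gadget_count_le. Qed.

Lemma no_defect j : j < num_clauses -> U j = 0 -> exists2 i, i < N & P (slot j i + 2).
Proof. by move=> ltj U0; apply: gadget_full => //; have := defect_add ltj; rewrite U0 /D; lia. Qed.

Lemma taut_lt gr r : gr < g -> r < t -> m + (t * gr + r) < num_clauses.
Proof.
move=> ltgr ltr; rewrite ltn_add2l.
have : t * gr.+1 <= t * g by rewrite leq_mul2l ltgr orbT.
by rewrite mulnS; lia.
Qed.

(** Both literals of the tautology belong to group [gr], so whichever [c] is chosen confines this
    group to one code word; a [c] at an empty position leaves the group empty. *)
Lemma taut_option gr r : gr < g -> r < t -> U (m + (t * gr + r)) = 0 ->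
  S gr = 0 \/ exists2 a, a < A & forall e, e < 2 * h -> P (2 * h * gr + e) -> code a e.
Proof.
move=> ltgr ltr U0; have ltj := taut_lt ltgr ltr.
have [i lti Pc] := no_defect ltj U0.
have ltv : t * gr + r < t * g by move: ltj; rewrite ltn_add2l.
have [l0 l1] := lit_taut ltv.
have lta : i %% A < A by rewrite ltn_mod A_gt0.
have /= := chosen_option ltj lti Pc; case: eqVneq => [_ no|Hl H].
  by left; rewrite /S big_nat big1 // => e lte; rewrite (negPf (no _ _ ltgr lte)).
right; exists (i %% A) => // e lte Px.
have Ev : (lit (m + (t * gr + r)) (i %/ A)).-1./2 = gr * t + r.
  case: (i %/ A) Hl => [|k] Hl; first by rewrite l0 addn2 /= mul2n uphalf_double mulnC.
  rewrite l1 //= in Hl *; case: ifP Hl => // _ _.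
  by rewrite addn1 /= mul2n doubleK mulnC.
rewrite Ev divnMDl ?t_gt0 // (divn_small ltr) addn0 in H.
by have /andP[] := H e lte Px.
Qed.

Lemma group_le gr : gr < g -> S gr <= 2 * h.
Proof.
by move=> ltgr; rewrite -[leqRHS]mul1n; apply: leq_sum_const => e _; case: (P _).
Qed.

(** Either some tautology of the group has no defect, and the group fits into a code word, or [t]
    defects outweigh at most [h] extra vertices. The strict inequality in the second case is what
    lets [defect_zero] exclude it. *)
Lemma group_bound gr : gr < g ->
  S gr <= h \/ S gr < h + \sum_(0 <= r < t) U (m + (t * gr + r)).
Proof.
move=> ltgr.
have [H|H] := boolP (has (fun r => U (m + (t * gr + r)) == 0) (iota 0 t)).
  left; have [r + /eqP U0] := hasP H; rewrite mem_iota /= => ltr.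
  have [->|[a lta sub]] := taut_option ltgr ltr U0; first exact: leq0n.
  rewrite -(code_weight lta) /S !big_nat leq_sum // => e lte.
  by case: (P _) (sub e lte) => // ->.
right; apply: leq_ltn_trans (group_le ltgr) _.
suff : t <= \sum_(0 <= r < t) U (m + (t * gr + r)) by lia.
rewrite -[leqLHS]mul1n; apply: leq_const_sum => r ltr.
by rewrite lt0n; apply: contra H => H; apply/hasP; exists r; rewrite ?mem_iota.
Qed.

(** By the size of [P], the sum of the [S gr] is at least [h * g] plus all defects; by [group_bound]
    it is at most [h * g] plus the defects of the tautologies. Hence formula clauses have no defect
    and every group bound is tight, which only the first alternative permits. One defect-free
    tautology per group is recorded, enough for [taut_option]. *)
Lemma defect_zero :
  (forall j, j < m -> U j = 0) /\
  forall gr, gr < g -> S gr = h /\ U (m + t * gr) = 0.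
Proof.
have tot : \sum_(0 <= j < num_clauses) D j + \sum_(0 <= j < num_clauses) U j =
    N.+1 * num_clauses.
  rewrite -big_split /= big_nat (eq_bigr (fun=> N.+1)); last exact: defect_add.
  by rewrite -big_nat sum_nat_const_nat subn0 mulnC.
move: sizeP; rewrite sum_vertices -/(\sum_(0 <= gr < g) S gr) -/(\sum_(0 <= j < num_clauses) D j).
have : \sum_(0 <= j < num_clauses) U j = \sum_(0 <= j < m) U j +
    \sum_(0 <= gr < g) \sum_(0 <= r < t) U (m + (t * gr + r)).
  rewrite (@big_cat_nat _ _ _ m) ?leq_addr //=; congr addn.
  rewrite -{1}[m]add0n big_addn addKn (sum_nat_mul t g).
  by apply: eq_bigr => gr _; apply: eq_bigr => r _; rewrite addnC.
set SU := \sum_(0 <= gr < g) \sum_(0 <= r < t) _ => EU.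
have Eh : h * g + SU = \sum_(0 <= gr < g) (h + \sum_(0 <= r < t) U (m + (t * gr + r))).
  by rewrite big_split /= sum_nat_const_nat subn0 mulnC.
have le gr : gr < g -> S gr <= h + \sum_(0 <= r < t) U (m + (t * gr + r)).
  by move=> ltgr; have [] := group_bound ltgr; lia.
have leS : \sum_(0 <= gr < g) S gr <= h * g + SU.
  by rewrite Eh !big_nat leq_sum.
rewrite /target => ge.
have U0 : \sum_(0 <= j < m) U j = 0 by lia.
split=> [j ltj|gr ltgr].
  apply/eqP; move/eqP: U0; rewrite sum_nat_seq_eq0 => /allP /(_ j).
  by rewrite mem_index_iota; apply.
have : S gr = h + \sum_(0 <= r < t) U (m + (t * gr + r)).
  by apply: (sum_nat_le_eq le) ltgr; rewrite -Eh; lia.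
have [leh Eq|lt Eq] := group_bound ltgr; last by lia.
have : \sum_(0 <= r < t) U (m + (t * gr + r)) = 0 by lia.
split; first lia.
apply/eqP; move/eqP: H; rewrite sum_nat_seq_eq0 => /allP /(_ 0).
by rewrite mem_index_iota addn0; apply; rewrite t_gt0.
Qed.

Lemma group_code gr : gr < g ->
  exists2 a, a < A & forall e, e < 2 * h -> P (2 * h * gr + e) = code a e.
Proof.
move=> ltgr; have [Sh U0] := defect_zero.2 gr ltgr.
rewrite -[t * gr]addn0 in U0.
have [|[a lta sub]] := taut_option ltgr t_gt0 U0; first lia.
exists a => //; apply: sum_bool_sub => //.
by rewrite code_weight // -/(S gr) Sh.
Qed.

Lemma group_nonempty gr : gr < g -> exists2 e, e < 2 * h & P (2 * h * gr + e).
Proof.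
move=> ltgr; have [Sh _] := defect_zero.2 gr ltgr.
apply/exists2P/not_existsP => none.
suff : S gr = 0 by lia.
by rewrite /S big_nat big1 // => e lte; apply/eqP; rewrite eqb0; apply/negP => Pe; case: (none e).
Qed.

Lemma solution_satisfies : exists f, forall j, j < m -> satisfied f j.
Proof.
have /boolp.choice [af afP] : forall gr, exists a, gr < g ->
    a < A /\ forall e, e < 2 * h -> P (2 * h * gr + e) = code a e.
  move=> gr; have [ltgr|] := ltnP gr g; last by exists 0; lia.
  by have [a lta H] := group_code ltgr; exists a.
exists (fun v => bit (af (v %/ t)) (v %% t)) => j ltj.
have ltj' : j < num_clauses by rewrite ltn_addr.
have [i lti Pc] := no_defect ltj' (defect_zero.1 j ltj).
have ltk : i %/ A < Q by rewrite ltn_divLR ?A_gt0.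
apply/hasP; exists (i %/ A); first by rewrite mem_iota.
(* An empty position would leave all groups empty, but group 0 is not. *)
have /= := chosen_option ltj' lti Pc; case: eqVneq => [_ no|l0 H].
  by have [e lte Pe] := group_nonempty g_gt0; have := no _ _ g_gt0 lte; rewrite Pe.
have ltl := lit_var ltj' ltk l0.
set l := lit j _ in l0 H ltl *.
have ltgr : l.-1./2 %/ t < g by rewrite ltn_divLR ?t_gt0 // mulnC.
have [e lte Pe] := group_nonempty ltgr.
have /andP[/eqP <- _] := H e lte Pe.
have [lta Ea] := afP _ ltgr; apply/eqP.
(* Both local assignments have the chosen vertices of the group as their code word: that of the slot
   contains these vertices, and there are [h] of them. *)
apply: code_inj => //; rewrite ?ltn_mod ?A_gt0 ?t_gt0 // => e' lte'.
rewrite -Ea //; apply: (@sum_bool_sub (2 * h) (fun e => P (2 * h * (l.-1./2 %/ t) + e))) => //.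
  by move=> e1 lte1 Pe1; have /andP[] := H e1 lte1 Pe1.
have [Sh _] := defect_zero.2 _ ltgr.
by rewrite code_weight ?ltn_mod ?A_gt0 //; move: Sh; rewrite /S => ->.
Qed.

End Soundness.

Theorem independentP :
  (exists2 P : nat -> bool, independent P & target <= \sum_(0 <= u < num_vertices) P u) <->
  (exists f, forall j, j < m -> satisfied f j).
Proof.
split=> [[P indP sizeP]|[f fsat]]; first exact: solution_satisfies indP sizeP.
by exists (solution f); [apply: solution_indep | apply: solution_count].
Qed.

Theorem vertex_coverP :
  has_vertex_cover graph budget%:Z <-> (exists f, forall j, j < m -> satisfied f j).
Proof.
rewrite -independentP.
have Eb : budget + target = num_vertices.
  rewrite /budget /target /num_vertices /num_modulator.
  have := N_gt0; rewrite mulnBl mul1n (mulSn N).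
  have -> : 3 * (N * num_clauses) = 2 * N * num_clauses + N * num_clauses by lia.
  move=> N0; have : num_clauses <= 2 * N * num_clauses by rewrite leq_pmull; lia.
  move: (2 * N * _) (N * _) => x y; lia.
have out (Y : {set 'I_num_vertices}) : #|Y| + #|~: Y| = num_vertices.
  by rewrite cardsC card_ord.
split=> [[Y [leY cov]]|[P indP sizeP]].
  exists (fun u => if insub u is Some x then x \notin Y else false).
    move=> u v ltu ltv; rewrite (insubT (fun i => i < num_vertices) ltu).
    rewrite (insubT (fun i => i < num_vertices) ltv) => nu nv.
    have inu : Ordinal ltu \in ~: Y by rewrite inE.
    have inv : Ordinal ltv \in ~: Y by rewrite inE.
    pose T (x : 'I_num_vertices) := x \in ~: Y.
    exact: (cov (exist T _ inu) (exist T _ inv)).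
  rewrite big_mkord (eq_bigr (fun x : 'I__ => nat_of_bool (x \notin Y))); last first.
    by move=> x _; rewrite valK.
  rewrite sum_bool_card.
  have -> : [set i | i \notin Y] = ~: Y by apply/setP => x; rewrite !inE.
  rewrite -(leq_add2l #|Y|) out; apply: leq_trans (eq_leq Eb).
  by rewrite leq_add2r -lez_nat.
exists [set x : 'I_num_vertices | ~~ P x]; split.
  rewrite lez_nat -(leq_add2r target); apply: leq_trans (eq_leq (esym Eb)).
  apply: leq_trans (eq_leq (out [set x : 'I_num_vertices | ~~ P x])).
  rewrite leq_add2l.
  have -> : ~: [set x : 'I_num_vertices | ~~ P x] = [set x : 'I_num_vertices | P x].
    by apply/setP => x; rewrite !inE negbK.
  by move: sizeP; rewrite big_mkord sum_bool_card.
move=> [x xin] [y yin]; rewrite /= /induced_edge /=.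
by move: xin yin; rewrite !inE !negbK; apply: indP.
Qed.

End Reduction.

(** * A program computing the graph *)

(** [sem_for] with a frame: every round may use that registers other than the counter and those
    written by the body are as before the loop. *)
Lemma for_rule r b c s (Inv : nat -> state -> Prop) :
  Inv (regs s b) (write_reg s r (regs s b)) ->
  (forall v s', v < regs s b ->
    (forall r', r' \notin r :: writes c -> regs s' r' = regs s r') ->
    Inv v.+1 s' -> Inv v (sem c (write_reg s' r v))) ->
  Inv 0 (sem (CFor r b c) s).
Proof.
move=> I0 IS.
pose fr s' := forall r', r' \notin r :: writes c -> regs s' r' = regs s r'.
suff [] : Inv 0 (sem (CFor r b c) s) /\ fr (sem (CFor r b c) s) by [].
apply: (sem_for (Inv := fun v s' => Inv v s' /\ fr s')) => [|v s' ltv [Is' frs']].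
  by split=> // r'; rewrite inE negb_or /= => /andP[/negPf -> _].
split; first exact: IS.
move=> r' nr'; have := nr'; rewrite inE negb_or => /andP[/negPf nr n'].
by rewrite sem_regs //= nr frs'.
Qed.

(** * Arithmetic and logic from addition and truncated subtraction *)

Section Expressions.

(** Truth is being nonzero, as for machine conditions, so [Add] is disjunction and subtraction from
    1 is negation. A double negation normalises to 0 or 1, as needed for values that are stored or
    counted. *)
Fixpoint mul_const (c : nat) (e : expr) : expr :=
  if c is c'.+1 then Add e (mul_const c' e) else Const 0.
Definition not_expr e := Defs.Sub (Const 1) e.
Definition and_expr e1 e2 := not_expr (Add (not_expr e1) (not_expr e2)).
Definition eq_expr e1 e2 := not_expr (Add (Defs.Sub e1 e2) (Defs.Sub e2 e1)).
Definition lt_expr e1 e2 := not_expr (not_expr (Defs.Sub e2 e1)).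
Definition some_expr := foldr Add (Const 0).

Definition holds s e := eval_expr s e != 0.

Variable s : state.

Lemma eval_mul_const c e : eval_expr s (mul_const c e) = c * eval_expr s e.
Proof. by elim: c => //= c ->. Qed.

Lemma holds_not e : holds s (not_expr e) = ~~ holds s e.
Proof. by rewrite /holds /=; lia. Qed.

Lemma holds_or e1 e2 : holds s (Add e1 e2) = holds s e1 || holds s e2.
Proof. by rewrite /holds /=; lia. Qed.

Lemma holds_and e1 e2 : holds s (and_expr e1 e2) = holds s e1 && holds s e2.
Proof. by rewrite holds_not holds_or !holds_not negb_or !negbK. Qed.

Lemma holds_eq e1 e2 : holds s (eq_expr e1 e2) = (eval_expr s e1 == eval_expr s e2).
Proof. by rewrite holds_not /holds /=; lia. Qed.

Lemma eval_lt e1 e2 :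
  eval_expr s (lt_expr e1 e2) = (eval_expr s e1 < eval_expr s e2).
Proof. by rewrite /=; lia. Qed.

Lemma holds_lt e1 e2 : holds s (lt_expr e1 e2) = (eval_expr s e1 < eval_expr s e2).
Proof. by rewrite /holds eval_lt; case: (_ < _). Qed.

Lemma holds_const (b : bool) : holds s (Const b) = b.
Proof. by case: b. Qed.

Lemma holds_some (T : eqType) (f : T -> expr) (P : T -> bool) (l : seq T) :
  (forall x, x \in l -> holds s (f x) = P x) ->
  holds s (some_expr [seq f x | x <- l]) = has P l.
Proof.
elim: l => [//|x l IH] H; rewrite [some_expr _]/= holds_or H ?mem_head //.
by rewrite IH // => y yl; apply: H; rewrite inE yl orbT.
Qed.

End Expressions.

(* The last group contains no variable of the formula: there is always at
   least one group, so that the modulator is not empty. *)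
Definition num_groups t n := (n + t.-1) %/ t + 1.

Lemma num_groups_gt0 t n : 0 < num_groups t n.
Proof. by rewrite /num_groups addn1. Qed.

Lemma num_groups_ge t n : 0 < t -> n <= t * num_groups t n.
Proof.
move=> t_gt0; rewrite /num_groups mulnDr muln1 mulnC.
have := divn_eq (n + t.-1) t; have := ltn_pmod (n + t.-1) t_gt0; lia.
Qed.

Lemma num_groups_le t n : t * num_groups t n <= n + 2 * t.
Proof.
rewrite /num_groups mulnDr muln1 mulnC.
have := divn_eq (n + t.-1) t; lia.
Qed.

Section Program.

Variables (h t Q A : nat) (bit code : nat -> nat -> bool).

Let N := Q * A.

(* Registers: 0 number of variables, 1 number of input clauses, 2 number of
   groups, 3 number of padded variables, 4 number of clauses, 5 number of
   vertices, 6 width [Q] of the clause table, 7 size of the modulator,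
   8 address of the clause table. *)
Definition parameter_values n m g :=
  [:: n; m; g; t * g; m + t * g; num_vertices h t Q A g m; Q; num_modulator h g;
      3 + num_vertices h t Q A g m + num_vertices h t Q A g m * num_vertices h t Q A g m].

Definition parameters k n m g s :=
  forall r, r < k -> regs s r = nth 0 (parameter_values n m g) r.

Definition slot_expr (j : expr) i := Add (Reg 7) (mul_const 3 (Add (mul_const N j) (Const i))).

Definition lit_expr (j : expr) k := Read (Add (Reg 8) (Add (mul_const Q j) (Const k))).

(** The tables [bit] and [code] are unfolded into the program as constants; they depend on [h] and
    [t] but not on the input. *)
Definition conflict_expr a l x gr :=
  Add (eq_expr l (Const 0)) (some_expr [seq some_expr [seq some_expr [seq
    and_expr (eq_expr l
      (Add (Const 1) (Add (mul_const 2 (Add (mul_const t gr) (Const r))) (Const (nat_of_bool s)))))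
      (and_expr (eq_expr x (Add (mul_const (2 * h) gr) (Const e)))
         (Const ((bit a r != s) || ~~ code a e)))
    | e <- iota 0 (2 * h)] | s <- [:: true; false]] | r <- iota 0 t]).

Definition arc_at_expr u v j gr i :=
  Add (and_expr (eq_expr v (Add (slot_expr j i) (Const 1)))
         (Add (eq_expr u (slot_expr j i)) (eq_expr u (Add (slot_expr j i) (Const 2)))))
  (Add (and_expr (Const (i.+1 < N)) (and_expr (eq_expr v (Add (slot_expr j i) (Const 3)))
         (Add (eq_expr u (Add (slot_expr j i) (Const 1)))
            (eq_expr u (Add (slot_expr j i) (Const 2))))))
       (and_expr (eq_expr u (Add (slot_expr j i) (Const 2)))
          (and_expr (lt_expr v (Reg 7))
             (conflict_expr (i %% A) (lit_expr j (i %/ A)) v gr)))).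

Definition adj_expr u v j gr :=
  Add (some_expr [seq arc_at_expr u v j gr i | i <- iota 0 N])
      (some_expr [seq arc_at_expr v u j gr i | i <- iota 0 N]).

Section Evaluation.

Variables (n m g : nat) (lit : nat -> nat -> nat) (s : state).
Hypothesis par : parameters 9 n m g s.
Let H := 3 + num_vertices h t Q A g m + num_vertices h t Q A g m * num_vertices h t Q A g m.
Hypothesis table : forall j k, j < num_clauses t g m -> k < Q ->
  memory s (H + Q * j + k) = lit j k.
Hypothesis A_gt0 : 0 < A.

Lemma holds_conflict a l x gr : holds s (conflict_expr a l x gr) =
  conflict h t bit code a (eval_expr s l) (eval_expr s x) (eval_expr s gr).
Proof.
rewrite holds_or holds_eq; congr (_ || _).
apply: holds_some => r _; apply: holds_some => b _; apply: holds_some => e _.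
rewrite !holds_and !holds_eq holds_const; congr (_ && (_ && _)).
  by congr (_ == _); rewrite /= eval_mul_const; lia.
by congr (_ == _); rewrite /= eval_mul_const.
Qed.

Lemma eval_slot j i : eval_expr s (slot_expr j i) = slot h Q A g (eval_expr s j) i.
Proof. by rewrite /= eval_mul_const /= (par (r := 7)) // !addn0 /slot; lia. Qed.

Lemma holds_arc_at u v j gr i :
  eval_expr s j < num_clauses t g m -> i < N ->
  holds s (arc_at_expr u v j gr i) =
  arc_at h t Q A bit code g lit
    (eval_expr s u) (eval_expr s v) (eval_expr s j) (eval_expr s gr) i.
Proof.
move=> ltj lti; rewrite /arc_at_expr.
rewrite !(holds_conflict, holds_or, holds_and, holds_eq, holds_const, holds_lt).
have -> : eval_expr s (lit_expr j (i %/ A)) = lit (eval_expr s j) (i %/ A).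
  rewrite /= eval_mul_const (par (r := 8)) //= addnA; apply: table => //.
  by rewrite ltn_divLR.
have E k : eval_expr s (Add (slot_expr j i) (Const k)) = slot h Q A g (eval_expr s j) i + k.
  by rewrite -eval_slot.
by rewrite !E eval_slot /= (par (r := 7)).
Qed.

Lemma holds_adj u v j gr u' v' j' gr' :
  eval_expr s u = u' -> eval_expr s v = v' -> eval_expr s j = j' ->
  eval_expr s gr = gr' -> j' < num_clauses t g m ->
  holds s (adj_expr u v j gr) =
    has (arc_at h t Q A bit code g lit u' v' j' gr') (iota 0 N) ||
    has (arc_at h t Q A bit code g lit v' u' j' gr') (iota 0 N).
Proof.
move=> <- <- <- <- ltj; rewrite /adj_expr holds_or.
by congr orb; apply: holds_some => i; rewrite mem_iota => lti; apply: holds_arc_at.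
Qed.

End Evaluation.

(** The common shape of the writing loops: round [v] fills the block number [v] of [w] cells. As the
    counter descends, the body may assume that memory outside the higher blocks is still the
    original one; [K] carries further invariants. *)
Lemma block_fill r b c s base w (F : nat -> nat -> nat) (K : nat -> state -> Prop) :
  0 < w -> K (regs s b) (write_reg s r (regs s b)) ->
  (forall v s', v < regs s b ->
    (forall r', r' \notin r :: writes c -> regs s' r' = regs s r') ->
    K v.+1 s' ->
    (forall a, ~~ (base + w * v.+1 <= a < base + w * regs s b) ->
       memory s' a = memory s a) ->
    K v (sem c (write_reg s' r v)) /\
    forall a, memory (sem c (write_reg s' r v)) a =
      if base + w * v <= a < base + w * v.+1 then F v (a - (base + w * v))
      else memory s' a) ->
  K 0 (sem (CFor r b c) s) /\
  forall a, memory (sem (CFor r b c) s) a =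
    if base <= a < base + w * regs s b then F ((a - base) %/ w) ((a - base) %% w)
    else memory s a.
Proof.
move=> w0 K0 step; set n := regs s b in K0 step *.
have := @for_rule r b c s (fun v s' => [/\ v <= n, K v s' & forall a,
  memory s' a = if base + w * v <= a < base + w * n
    then F ((a - base) %/ w) ((a - base) %% w) else memory s a]).
rewrite muln0 addn0 => -[|v s' ltv fr [_ Kv mem]|_ K' mem //].
- by split=> // a; rewrite ifN //; lia.
have [|K' mem'] := step v s' ltv fr Kv.
  by move=> a na; rewrite mem (negPf na).
split=> //; first exact: ltnW.
move=> a; rewrite mem' mem.
have lew : w * v.+1 <= w * n by rewrite leq_mul2l ltv orbT.
have [le1|lt1] := leqP (base + w * v) a => /=; last by rewrite ifN //; rewrite mulnS; lia.
have [lt2|le2] /= := ltnP a (base + w * v.+1).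
  have -> : a < base + w * n by lia.
  have -> : a - base = v * w + (a - (base + w * v)) by rewrite [v * w]mulnC; lia.
  have ltx : a - (base + w * v) < w by rewrite mulnS in lt2; lia.
  by rewrite divnMDl // divn_small // addn0 modnMDl modn_small.
by [].
Qed.

(** * The stages of the preprocessing program *)

Definition read_header :=
  CSeq (CAssign 0 (Read (Const 0))) (CAssign 1 (Read (Const 1))).

(** Division by counting: the number of [x < n] with [t * x < n] is [n / t] rounded up. The initial
    1 is the additional group. *)
Definition set_sizes :=
  CSeq (CAssign 2 (Const 1))
  (CSeq (CFor 9 0 (CAssign 2 (Add (Reg 2) (lt_expr (mul_const t (Reg 9)) (Reg 0)))))
  (CSeq (CAssign 3 (mul_const t (Reg 2)))
  (CSeq (CAssign 4 (Add (Reg 1) (Reg 3)))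
  (CSeq (CAssign 7 (mul_const (2 * h) (Reg 2)))
  (CSeq (CAssign 5 (Add (Reg 7) (mul_const 3 (mul_const N (Reg 4)))))
        (CAssign 6 (Const Q))))))).

(** The square of the number of vertices is built by repeated addition. The table is placed right
    behind the output, and by [size_input] also behind the input. *)
Definition set_table_address :=
  CSeq (CAssign 8 (Add (Const 3) (Reg 5))) (CFor 9 5 (CAssign 8 (Add (Reg 8) (Reg 5)))).

Definition copy_clause :=
  CFor 13 6 (CIf (lt_expr (Reg 13) (Reg 12))
    (CStore (Add (Reg 11) (Reg 13))
       (Add (Const 1) (Read (Add (Add (Reg 10) (Const 1)) (Reg 13)))))
    (CStore (Add (Reg 11) (Reg 13)) (Const 0))).

(** Register 10 is the reading position in the input, 11 the current row of the table, and 12 the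
    length of the clause. *)
Definition load_clause :=
  CSeq (CAssign 12 (Read (Reg 10)))
  (CSeq copy_clause
  (CSeq (CAssign 10 (Add (Add (Reg 10) (Const 1)) (Reg 12)))
        (CAssign 11 (Add (Reg 11) (Reg 6))))).

(** Positions from 2 on are left alone: these cells still hold 0, the code of an empty position. *)
Definition load_tautologies :=
  CFor 9 3
  (CSeq (CStore (Add (Reg 11) (mul_const Q (Reg 9)))
           (Add (mul_const 2 (Reg 9)) (Const 2)))
        (CStore (Add (Add (Reg 11) (mul_const Q (Reg 9))) (Const 1))
           (Add (mul_const 2 (Reg 9)) (Const 1)))).

Definition load_table :=
  CSeq (CAssign 10 (Const 2)) (CSeq (CAssign 11 (Reg 8))
  (CSeq (CFor 9 1 load_clause) load_tautologies)).

Definition budget_expr := Add (mul_const h (Reg 2)) (mul_const (2 * N - 1) (Reg 4)).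

Definition write_prefix :=
  CSeq (CStore (Const 0) (Reg 5)) (CSeq (CStore (Const 1) (Const 0))
  (CSeq (CStore (Const 2) budget_expr)
        (CFor 9 5 (CStore (Add (Const 3) (Reg 9)) (lt_expr (Reg 9) (Reg 7)))))).

Definition test_edge :=
  CFor 15 4 (CFor 16 2
    (CAssign 14 (Add (Reg 14) (adj_expr (Reg 9) (Reg 13) (Reg 15) (Reg 16))))).

Definition write_row :=
  CFor 13 5 (CSeq (CAssign 14 (Const 0)) (CSeq test_edge
    (CStore (Add (Reg 10) (Reg 13)) (not_expr (not_expr (Reg 14)))))).

(** Rows are written from the last to the first, following the descending counter; register 10 moves
    down from the end of the matrix. *)
Definition write_matrix :=
  CSeq (CAssign 10 (Reg 8))
       (CFor 9 5 (CSeq (CAssign 10 (Defs.Sub (Reg 10) (Reg 5))) write_row)).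

(** The cells behind the output must be 0 again, since the subsequent algorithm is specified on
    initial states only. *)
Definition clear_table :=
  CFor 9 4 (CFor 13 6
    (CStore (Add (Add (Reg 8) (mul_const Q (Reg 9))) (Reg 13)) (Const 0))).

(** The formula is copied into the table first, because the output overwrites the input. *)
Definition transform :=
  CSeq load_table (CSeq write_prefix (CSeq write_matrix clear_table)).

Definition clear_registers :=
  foldr (fun r c => CSeq (CAssign r (Const 0)) c) (CAssign 16 (Const 0)) (iota 0 16).

(** No stage may write its own loop bounds, so each stage computes registers that bound the loops of
    later ones; this is why the threshold grows from 0 to 2, 8 and 9. *)
Lemma program_well_formed :
  [/\ well_formed 0 read_header, well_formed 2 set_sizes,
      well_formed 8 set_table_address, well_formed 9 transform
    & well_formed 0 clear_registers].
Proof. by []. Qed.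

Hypotheses (h_gt0 : 0 < h) (t_gt0 : 0 < t) (A_gt0 : 0 < A) (Q_gt1 : 1 < Q).

Lemma set_sizesP n m s : regs s 0 = n -> regs s 1 = m ->
  parameters 8 n m (num_groups t n) (sem set_sizes s) /\
  memory (sem set_sizes s) = memory s.
Proof.
move=> E0 E1; rewrite [sem _ _]/=; set s1 := iteri _ _ _.
pose ceil := (n + t.-1) %/ t.
have cle : ceil <= n.
  by rewrite /ceil -ltnS ltn_divLR //; nia.
have cP x : (t * x < n) = (x < ceil).
  by rewrite /ceil leq_divRL // mulnC mulSn; lia.
have := @for_rule 9 0
  (CAssign 2 (Add (Reg 2) (lt_expr (mul_const t (Reg 9)) (Reg 0))))
  (write_reg s 2 1) (fun v s' => regs s' 2 = 1 + (ceil - v) /\ memory s' = memory s).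
rewrite -[sem _ _]/s1 [regs _ 0]/= E0 => -[|v s' ltv fr [R2 mem]|R2 mem].
- by rewrite /= (eqP cle) addn0.
- split=> //; rewrite [regs _ 2]/= eval_mul_const /= R2 (fr 0 isT) /= E0.
  by have := cP v; lia.
have fr r : r \notin [:: 2; 9] -> regs s1 r = regs s r.
  rewrite !inE negb_or => /andP[n2 n9].
  have -> : regs s1 r = regs (sem (CFor 9 0
    (CAssign 2 (Add (Reg 2) (lt_expr (mul_const t (Reg 9)) (Reg 0))))) (write_reg s 2 1)) r.
    by [].
  by rewrite sem_regs /= ?(negPf n2) // !inE negb_or n9 n2.
have G : regs s1 2 = num_groups t n by rewrite R2 subn0 addnC.
split=> //; case=> [|[|[|[|[|[|[|[|//]]]]]]]] _ /=;
  rewrite ?eval_mul_const /= ?eval_mul_const /= ?G ?(fr 0) ?(fr 1) ?E0 ?E1 //=;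
  rewrite ?eval_mul_const /= ?G //.
Qed.

Lemma set_table_addressP n m g s : parameters 8 n m g s ->
  parameters 9 n m g (sem set_table_address s) /\
  memory (sem set_table_address s) = memory s.
Proof.
move=> par; set M := num_vertices h t Q A g m.
have E5 : regs s 5 = M by rewrite par.
set s1 := write_reg s 8 (3 + M).
have Es : sem set_table_address s = sem (CFor 9 5 (CAssign 8 (Add (Reg 8) (Reg 5)))) s1.
  by rewrite /s1 -E5.
rewrite Es; set s2 := sem _ _.
have := @for_rule 9 5 (CAssign 8 (Add (Reg 8) (Reg 5))) s1
  (fun v s' => [/\ v <= M, regs s' 8 = 3 + M + (M - v) * M & memory s' = memory s]).
rewrite -/s2 [regs s1 5]/= E5 => -[|v s' ltv fr [_ R8 mem]|_ R8 mem].
- by rewrite /= subnn mul0n addn0.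
- split=> //; first exact: ltnW.
  by rewrite /= R8 (fr 5 isT) /= E5 -addnA -mulSnr subnSK.
split=> // r; rewrite ltnS leq_eqVlt => /orP[/eqP ->|ltr].
  by rewrite R8 subn0.
rewrite /s2 sem_regs; last by rewrite !inE negb_or; apply/andP; split; lia.
by rewrite /= ifN ?par //; lia.
Qed.

(** * Correctness of the preprocessing program *)

Section Transform.

Variables (n g : nat) (clauses : seq (seq nat)).
Hypothesis g_gt0 : 0 < g.
Hypothesis clause_size : forall j, size (nth [::] clauses j) <= Q.

Let m := size clauses.
Let M := num_vertices h t Q A g m.
Let H := 3 + M + M * M.
Let m' := num_clauses t g m.

Definition input_word := [:: n, m & flatten [seq size c :: c | c <- clauses]].

Definition lit j k :=
  if j < m then
    let c := nth [::] clauses j in if k < size c then (nth 0 c k).+1 else 0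
  else if k == 0 then 2 * (j - m) + 2 else if k == 1 then 2 * (j - m) + 1 else 0.

Let pos j := 2 + size (flatten (take j [seq size c :: c | c <- clauses])).

Lemma pos_step j : j < m -> pos j.+1 = pos j + (size (nth [::] clauses j)).+1 /\
  forall x, x <= size (nth [::] clauses j) ->
  nth 0 input_word (pos j + x) =
    nth 0 (size (nth [::] clauses j) :: nth [::] clauses j) x.
Proof.
move=> ltj; set C := [seq size c :: c | c <- clauses].
set c := nth [::] clauses j.
have sC : size C = m by rewrite size_map.
have nC : nth [::] C j = size c :: c by rewrite (nth_map [::]).
split.
  by rewrite /pos (take_nth [::]) ?sC // nC flatten_rcons size_cat addnA.
move=> x lex; rewrite /input_word -/C /pos -/C -addnA add2n /=.
have -> : flatten C = flatten (take j C) ++ flatten (drop j C).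
  by rewrite -flatten_cat cat_take_drop.
rewrite nth_cat ltnNge leq_addr /= addKn.
by rewrite (drop_nth [::]) ?sC // nC /= -cat_cons nth_cat /= ltnS lex.
Qed.

(** The input has at most [2 + m * Q.+1] cells, and the graph alone has at least [3 * (Q * m)]
    vertices. Hence the table area is initially zero and loading the table destroys no input. *)
Lemma size_input : size input_word <= H.
Proof.
have -> : size input_word = pos m.
  by rewrite /pos take_oversize ?size_map.
have le j : j <= m -> pos j <= 2 + j * Q.+1.
  elim: j => [|j IH] ltj; first by rewrite /pos take0.
  rewrite (pos_step ltj).1 mulSn; have := IH (ltnW ltj).
  by have := clause_size j; lia.
apply: leq_trans (le m (leqnn m)) _; rewrite /H /M /num_vertices /num_clauses.
have : m * Q <= N * (m + t * g).
  by rewrite mulnC; apply: leq_mul; rewrite ?leq_pmulr ?leq_addr.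
have : m * 1 <= m * Q by rewrite leq_mul2l; apply/orP; right; lia.
rewrite muln1 mulnS; move: (m * Q) (N * _) (_ * _) => x y z; lia.
Qed.

Lemma table_in j k : j < m' -> k < Q -> H <= H + Q * j + k < H + Q * m'.
Proof.
move=> ltj ltk; rewrite -addnA leq_addr ltn_add2l.
have : Q * j.+1 <= Q * m' by rewrite leq_mul2l ltj orbT.
by rewrite mulnS; lia.
Qed.

Lemma load_clauseP j s : j < m -> parameters 9 n m g s ->
  regs s 10 = pos j -> regs s 11 = H + Q * j ->
  (forall a, a < H -> memory s a = nth 0 input_word a) ->
  [/\ regs (sem load_clause s) 10 = pos j.+1,
      regs (sem load_clause s) 11 = H + Q * j.+1 &
      forall a, memory (sem load_clause s) a =
        if H + Q * j <= a < H + Q * j.+1 then lit j (a - (H + Q * j)) else memory s a].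
Proof.
move=> ltj par R10 R11 inp; have [posS nthw] := pos_step ltj.
set c := nth [::] clauses j in posS nthw *.
have posH : pos j + (size c).+1 <= H.
  rewrite -posS; apply: leq_trans size_input; rewrite /pos /= leq_add2l //.
  have -> : flatten [seq size c :: c | c <- clauses] =
    flatten (take j.+1 [seq size c :: c | c <- clauses]) ++
    flatten (drop j.+1 [seq size c :: c | c <- clauses]).
    by rewrite -flatten_cat cat_take_drop.
  by rewrite size_cat leq_addr.
set s1 := write_reg s 12 (size c).
have Es : sem load_clause s =
  sem (CSeq (CAssign 10 (Add (Add (Reg 10) (Const 1)) (Reg 12)))
        (CAssign 11 (Add (Reg 11) (Reg 6)))) (sem copy_clause s1).
  rewrite /load_clause /s1; cbn [sem].
  have -> // : eval_expr s (Read (Reg 10)) = size c.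
  rewrite /= R10 inp; last by lia.
  by rewrite -[pos j]addn0 nthw.
have R6 : regs s 6 = Q by rewrite par.
have fr r : r != 13 -> regs (sem copy_clause s1) r = regs s1 r.
  by move=> nr; rewrite sem_regs //= inE.
have [_ mem] : True /\ forall a, memory (sem copy_clause s1) a =
    if H + Q * j <= a < H + Q * j + 1 * regs s1 6 then
      lit j ((a - (H + Q * j)) %/ 1) else memory s1 a.
  apply: (@block_fill 13 6 _ s1 (H + Q * j) 1 (fun x _ => lit j x)
    (fun _ _ => True)) => // v s' ltv fr' _ mem.
  rewrite [regs s1 6]/= R6 in ltv; split=> // a.
  have R12' : regs s' 12 = size c by rewrite (fr' 12 isT).
  have R11' : regs s' 11 = H + Q * j by rewrite (fr' 11 isT).
  have R10' : regs s' 10 = pos j by rewrite (fr' 10 isT).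
  rewrite [sem _ _]/= R12' R11' R10' /lit ltj -/c !mul1n.
  have [ltvc|levc] := ltnP v (size c).
    have -> : 1 - (1 - (size c - v)) != 0 by lia.
    rewrite /= mem; last by lia.
    rewrite inp; last by lia.
    rewrite -[pos j + 1 + v]addnA add1n nthw //=.
    have [->|ne] := eqVneq a (H + Q * j + v); last by rewrite ifN //; lia.
    by rewrite leqnn addnS ltnSn.
  have -> : (1 - (1 - (size c - v)) != 0) = false by lia.
  rewrite /=.
  have [->|ne] := eqVneq a (H + Q * j + v); last by rewrite ifN //; lia.
  by rewrite leqnn addnS ltnSn.
move: (sem copy_clause s1) Es fr mem => s2 -> fr mem.
rewrite /= !fr //= R10 R11 R6; split.
- by rewrite posS -addnA add1n.
- by rewrite mulnS; lia.
by move=> a; rewrite mem divn1 [regs s1 6]/= R6 mul1n mulnS [Q + _]addnC addnA.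
Qed.

Lemma load_tableP s : parameters 9 n m g s -> memory s = nth 0 input_word ->
  [/\ parameters 9 n m g (sem load_table s),
    (forall j k, j < m' -> k < Q -> memory (sem load_table s) (H + Q * j + k) = lit j k) &
    forall a, H + Q * m' <= a -> memory (sem load_table s) a = 0].
Proof.
move=> par mem.
have out a : H <= a -> memory s a = 0.
  by move=> lea; rewrite mem nth_default // (leq_trans size_input).
set s1 := write_reg (write_reg s 10 2) 11 H.
set s2 := sem (CFor 9 1 load_clause) s1.
have Es : sem load_table s = sem load_tautologies s2.
  have E8 : regs s 8 = H by rewrite par.
  by rewrite /s2 /s1 -E8.
have [R11 mem2] : regs s2 11 = H + Q * m /\ forall a, memory s2 a =
    if H <= a < H + Q * m then lit ((a - H) %/ Q) ((a - H) %% Q) else memory s a.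
  (* The counter descends while clauses are read in increasing order: at value [v], the first
     [m - v] clauses are loaded. *)
  have := @for_rule 9 1 load_clause s1 (fun v s' => [/\ v <= m, 
    regs s' 10 = pos (m - v) & regs s' 11 = H + Q * (m - v) /\
    forall a, memory s' a = if H <= a < H + Q * (m - v)
      then lit ((a - H) %/ Q) ((a - H) %% Q) else memory s a]).
  have -> : regs s1 1 = m by rewrite /s1 /= par.
  rewrite -/s2 => -[|v s' ltv fr [_ R10 [R11 mem']]|_ _ //]; last by rewrite subn0.
    rewrite subnn /= muln0 addn0 /pos take0; split=> //; split=> // a.
    by rewrite ifN //; lia.
  have ltj : m - v.+1 < m by lia.
  have jS : (m - v.+1).+1 = m - v by lia.
  have par' : parameters 9 n m g (write_reg s' 9 v).
    move=> r ltr; rewrite /= ifN; last by lia.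
    rewrite fr.
      by rewrite /s1 /= !ifN ?par //; lia.
    by rewrite !inE; lia.
  have [|||P10 P11 memL] := @load_clauseP _ (write_reg s' 9 v) ltj par'.
  - by rewrite /= R10.
  - by rewrite /= R11.
  - by move=> a lta /=; rewrite mem' ifN ?mem //; lia.
  rewrite jS in P10 P11 memL; split; [exact: ltnW|by []|split=> // a].
  rewrite memL /= mem'.
  have lt1 : Q * (m - v) = Q * (m - v.+1) + Q by rewrite -jS mulnS addnC.
  case: ifP => [/andP[le lt]|]; last first.
    by move=> nb; congr (if _ then _ else _); apply/idP/idP; lia.
  rewrite (leq_trans (leq_addr _ _) le) lt /=; rewrite lt1 in lt.
  have -> : a - H = (m - v.+1) * Q + (a - (H + Q * (m - v.+1))).
    by rewrite [_ * Q]mulnC; move: (Q * _) le => y; lia.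
  have ltx : a - (H + Q * (m - v.+1)) < Q by move: (Q * _) le lt => y; lia.
  have Q0 : 0 < Q by lia.
  by rewrite divnMDl // divn_small // addn0 modnMDl modn_small.
have par2 : parameters 9 n m g s2.
  move=> r ltr; rewrite /s2 sem_regs ?(well_formed_writes (k := 9)) //.
  by rewrite /s1 /= !ifN ?par //; lia.
have R3 : regs s2 3 = t * g by rewrite par2.
have [_ mem3] : True /\ forall a, memory (sem load_tautologies s2) a =
    if H + Q * m <= a < H + Q * m + Q * regs s2 3 then
      lit (m + (a - (H + Q * m)) %/ Q) ((a - (H + Q * m)) %% Q) else memory s2 a.
  apply: (@block_fill 9 3 _ s2 (H + Q * m) Q (fun x => lit (m + x))
    (fun _ _ => True)) => //; first by lia.
  move=> v s' ltv fr' _ mem'; rewrite R3 in ltv mem'; split=> // a.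
  have R11' : regs s' 11 = H + Q * m by rewrite (fr' 11 isT).
  have litE k : lit (m + v) k =
      if k == 0 then 2 * v + 2 else if k == 1 then 2 * v + 1 else 0.
    by rewrite /lit ltnNge leq_addr /= addKn.
  rewrite litE [sem _ _]/= !eval_mul_const /= R11'.
  set b := H + Q * m + Q * v.
  have lev : Q * v.+1 <= Q * (t * g) by rewrite leq_mul2l ltv orbT.
  have -> : H + Q * m + Q * v.+1 = b + Q by rewrite /b mulnS; lia.
  have [->|n1] := eqVneq a (b + 1).
    by rewrite leq_addr ltn_add2l Q_gt1 addKn /=; lia.
  have [->|n0] := eqVneq a b.
    by rewrite leqnn -ltn_subLR // subnn ltnW //=; lia.
  case: ifP => // /andP[le lt]; have -> : (a - b == 0) = false by lia.
  have -> : (a - b == 1) = false by lia.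
  rewrite mem' ?mem2; last by rewrite /b in le lt *; rewrite mulnS; lia.
  by rewrite ifN ?out //; rewrite /b in le lt; lia.
rewrite Es; split.
- move=> r ltr; rewrite sem_regs ?par2 // (well_formed_writes (k := 9)) //.
- move=> j k ltj ltk.
  have [ltjm|lemj] := ltnP j m.
    have lt2 : Q * j.+1 <= Q * m by rewrite leq_mul2l ltjm orbT.
    rewrite mulnS in lt2.
    rewrite mem3 ifN; last by lia.
    rewrite mem2 ifT; last by lia.
    rewrite -addnA addKn [Q * j]mulnC.
    have Q0 : 0 < Q by lia.
    by rewrite divnMDl // divn_small // addn0 modnMDl modn_small.
  have := table_in ltj ltk; rewrite /m' /num_clauses mulnDr addnA => /andP[_ lt].
  have Q0 : 0 < Q by lia.
  have E : H + Q * j + k = H + Q * m + ((j - m) * Q + k).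
    by rewrite mulnBl [j * Q]mulnC [m * Q]mulnC; have : Q * m <= Q * j; [rewrite leq_mul2l lemj orbT|lia].
  rewrite mem3 R3 ifT; last by rewrite lt E leq_addr.
  by rewrite E addKn divnMDl // divn_small // addn0 modnMDl modn_small // subnKC.
- move=> a; rewrite /m' /num_clauses mulnDr addnA => lea.
  rewrite mem3 R3 ifN; last by lia.
  rewrite mem2 ifN; last by lia.
  by rewrite out; lia.
Qed.

Lemma write_prefixP s : parameters 9 n m g s ->
  parameters 9 n m g (sem write_prefix s) /\
  forall a, memory (sem write_prefix s) a =
    if a < 3 then nth 0 [:: M; 0; budget h t Q A g m] a
    else if a < 3 + M then (a - 3 < num_modulator h g : nat) else memory s a.
Proof.
move=> par; split.
  by move=> r ltr; rewrite sem_regs ?par // (well_formed_writes (k := 9)).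
set s1 := sem (CSeq (CStore (Const 0) (Reg 5)) (CSeq (CStore (Const 1) (Const 0))
  (CStore (Const 2) budget_expr))) s.
set fill := CFor 9 5 (CStore (Add (Const 3) (Reg 9)) (lt_expr (Reg 9) (Reg 7))).
have -> : sem write_prefix s = sem fill s1 by [].
have R5 : regs s1 5 = M by rewrite /= par.
have [_ mem] : True /\ forall a, memory (sem fill s1) a =
    if 3 <= a < 3 + 1 * regs s1 5 then
      nat_of_bool ((a - 3) %/ 1 < num_modulator h g) else memory s1 a.
  apply: (@block_fill 9 5 _ s1 3 1 (fun x _ => nat_of_bool (x < num_modulator h g))
    (fun _ _ => True)) => // v s' ltv fr _ _; split=> // a.
  rewrite [sem _ _]/= !mul1n addnS ltnS -eqn_leq (fr 7 isT) /= par //= eq_sym.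
  by case: eqP => // _; lia.
move=> a; rewrite mem R5 mul1n divn1.
case: (ltnP a 3) => [lta|lea] /=; last first.
  case: ifP => // _; rewrite /= ifN; last by lia.
  by rewrite ifN; [rewrite ifN //; lia | lia].
case: a lta => [|[|[|//]]] _ //=.
by rewrite !eval_mul_const /= !par.
Qed.

Let edge_test u v j gr :=
  has (arc_at h t Q A bit code g lit u v j gr) (iota 0 N) ||
  has (arc_at h t Q A bit code g lit v u j gr) (iota 0 N).

Lemma adjE u v : adj h t Q A bit code g m lit u v =
  has (fun j => has (edge_test u v j) (iota 0 g)) (iota 0 m').
Proof.
rewrite /adj /arc -has_predU; apply: eq_has => j /=.
by rewrite -has_predU; apply: eq_has.
Qed.

Definition table_loaded (s : state) :=
  forall j k, j < m' -> k < Q -> memory s (H + Q * j + k) = lit j k.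

Lemma test_edgeP u v s : parameters 9 n m g s -> table_loaded s ->
  regs s 9 = u -> regs s 13 = v -> regs s 14 = 0 ->
  (regs (sem test_edge s) 14 != 0) = adj h t Q A bit code g m lit u v /\
  memory (sem test_edge s) = memory s.
Proof.
move=> par tab R9 R13 R14.
have R4 : regs s 4 = m' by rewrite par.
have := @for_rule 15 4 (CFor 16 2
    (CAssign 14 (Add (Reg 14) (adj_expr (Reg 9) (Reg 13) (Reg 15) (Reg 16))))) s
  (fun x s' => [/\ x <= m', memory s' = memory s & (regs s' 14 != 0) =
    has (fun j => has (edge_test u v j) (iota 0 g)) (iota x (m' - x))]).
rewrite R4 -/test_edge => -[|j s' ltj fr [_ mem E]|_ mem E].
- by rewrite subnn /= R14; split.
- set s1 := write_reg s' 15 j.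
  have par1 : parameters 9 n m g s1.
    move=> r ltr; rewrite /= ifN; last by lia.
    by rewrite fr ?par // !inE; lia.
  have R2 : regs s1 2 = g by rewrite par1.
  have := @for_rule 16 2
    (CAssign 14 (Add (Reg 14) (adj_expr (Reg 9) (Reg 13) (Reg 15) (Reg 16)))) s1
    (fun x s2 => [/\ x <= g, memory s2 = memory s & (regs s2 14 != 0) =
      (regs s1 14 != 0) || has (edge_test u v j) (iota x (g - x))]).
  rewrite R2 => -[|gr s2 ltgr fr2 [_ mem2 E2]|_ mem2 E2].
  + by rewrite subnn /= orbF.
  + set s3 := write_reg s2 16 gr.
    have par3 : parameters 9 n m g s3.
      move=> r ltr; rewrite /= ifN; last by lia.
      by rewrite fr2 ?par1 // !inE; lia.
    have tab3 : table_loaded s3 by move=> *; rewrite /= mem2 tab.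
    split=> //; first exact: ltnW.
    have Eh : holds s3 (adj_expr (Reg 9) (Reg 13) (Reg 15) (Reg 16)) = edge_test u v j gr.
      apply: (holds_adj par3 tab3 A_gt0) => //=.
      - by rewrite (fr2 9 isT) /= (fr 9 isT).
      - by rewrite (fr2 13 isT) /= (fr 13 isT).
      - by rewrite (fr2 15 isT).
    rewrite -[LHS]/(holds s3 (Add (Reg 14) (adj_expr (Reg 9) (Reg 13) (Reg 15) (Reg 16)))).
    rewrite holds_or Eh -(subnSK ltgr) [iota _ _]/= [has _ (_ :: _)]/=.
    rewrite -[holds _ _]/(regs s2 14 != 0) E2.
    by rewrite -orbA; congr (_ || _); exact: orbC.
  + split; [exact: ltnW|exact: mem2|].
    by rewrite E2 /= E subn0 -(subnSK ltj) /= orbC.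
- by rewrite E adjE subn0.
Qed.

Lemma M_gt0 : 0 < M.
Proof. by rewrite addn_gt0 /num_modulator !muln_gt0 h_gt0 g_gt0. Qed.

Lemma write_rowP u s : u < M -> parameters 9 n m g s -> table_loaded s ->
  regs s 9 = u -> regs s 10 = 3 + M + M * u ->
  forall a, memory (sem write_row s) a =
    if 3 + M + M * u <= a < 3 + M + M * u.+1 then
      nat_of_bool (adj h t Q A bit code g m lit u (a - (3 + M + M * u)))
    else memory s a.
Proof.
move=> ltu par tab R9 R10.
have R5 : regs s 5 = M by rewrite par.
have [_ mem] : True /\ forall a, memory (sem write_row s) a =
    if 3 + M + M * u <= a < 3 + M + M * u + 1 * regs s 5 then
      nat_of_bool (adj h t Q A bit code g m lit u ((a - (3 + M + M * u)) %/ 1))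
    else memory s a.
  apply: (@block_fill 13 5 _ s (3 + M + M * u) 1
    (fun x _ => nat_of_bool (adj h t Q A bit code g m lit u x))
    (fun _ _ => True)) => // v s' ltv fr _ mem; split=> // a.
  set s1 := write_reg (write_reg s' 13 v) 14 0.
  have par1 : parameters 9 n m g s1.
    move=> r ltr; rewrite /= !ifN; try lia.
    by rewrite fr ?par // !inE; lia.
  have tab1 : table_loaded s1.
    move=> j k ltj ltk; rewrite /= mem ?tab //.
    have := table_in ltj ltk => /andP[le _].
    have : M * u.+1 <= M * M by rewrite leq_mul2l ltu orbT.
    by rewrite R5 mulnS mul1n; move: le; rewrite /H; lia.
  have [E Em] := @test_edgeP u v s1 par1 tab1 (etrans (fr 9 isT) R9) erefl erefl.
  rewrite -[sem _ _]/(let s2 := sem test_edge s1 in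
    write_mem s2 (regs s2 10 + regs s2 13) (1 - (1 - regs s2 14))).
  move: (sem test_edge s1) E Em (sem_regs (c := test_edge) s1)
    => s2 E Em fr2.
  rewrite /= Em /= (fr2 10) // (fr2 13) //= (fr 10 isT) R10 !mul1n addnS ltnS -eqn_leq eq_sym.
  by case: eqP => // _; rewrite -E; case: (regs s2 14).
by move=> a; rewrite mem R5 mul1n divn1 mulnS [M + _]addnC addnA.
Qed.

Lemma write_matrixP s : parameters 9 n m g s -> table_loaded s ->
  parameters 9 n m g (sem write_matrix s) /\
  forall a, memory (sem write_matrix s) a =
    if 3 + M <= a < H then nat_of_bool (adj h t Q A bit code g m lit
      ((a - (3 + M)) %/ M) ((a - (3 + M)) %% M))
    else memory s a.
Proof.
move=> par tab; split.
  by move=> r ltr; rewrite sem_regs ?par // (well_formed_writes (k := 9)).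
set s1 := write_reg s 10 H.
set rows := CFor 9 5 (CSeq (CAssign 10 (Defs.Sub (Reg 10) (Reg 5))) write_row).
have -> : sem write_matrix s = sem rows s1.
  have E8 : regs s 8 = H by rewrite par.
  by rewrite /s1 -E8.
have R5 : regs s1 5 = M by rewrite /= par.
have [_ mem] : regs (sem rows s1) 10 = 3 + M + M * 0 /\
    forall a, memory (sem rows s1) a =
    if 3 + M <= a < 3 + M + M * regs s1 5 then
      nat_of_bool (adj h t Q A bit code g m lit ((a - (3 + M)) %/ M) ((a - (3 + M)) %% M))
    else memory s1 a.
  apply: (@block_fill 9 5 _ s1 (3 + M) M
    (fun u v => nat_of_bool (adj h t Q A bit code g m lit u v))
    (fun v s' => regs s' 10 = 3 + M + M * v)); first exact: M_gt0.
    by rewrite R5 /=.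
  rewrite R5 => v s' ltv fr R10 mem.
  have R5' : regs s' 5 = M by rewrite (fr 5 isT).
  set s2 := write_reg (write_reg s' 9 v) 10 (3 + M + M * v).
  have -> : sem (CSeq (CAssign 10 (Defs.Sub (Reg 10) (Reg 5))) write_row)
      (write_reg s' 9 v) = sem write_row s2.
    rewrite -[LHS]/(sem write_row
      (write_reg (write_reg s' 9 v) 10 (regs s' 10 - regs s' 5))).
    by rewrite R10 R5' mulnS [M + M * v]addnC addnA addnK.
  have par2 : parameters 9 n m g s2.
    move=> r ltr; rewrite /= !ifN; try lia.
    rewrite fr; first by rewrite /= ifN ?par //; lia.
    by rewrite !inE; lia.
  have tab2 : table_loaded s2.
    move=> j k ltj ltk; rewrite /= mem ?tab //.
    by have := table_in ltj ltk; rewrite /H => /andP[le _]; lia.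
  split; first by rewrite sem_regs.
  exact: (write_rowP ltv par2 tab2).
by move=> a; rewrite mem R5.
Qed.

Lemma clear_tableP s : parameters 9 n m g s ->
  forall a, memory (sem clear_table s) a =
    if H <= a < H + Q * m' then 0 else memory s a.
Proof.
move=> par.
have R4 : regs s 4 = m' by rewrite par.
have [_ mem] : True /\ forall a, memory (sem clear_table s) a =
    if H <= a < H + Q * regs s 4 then 0 else memory s a.
  apply: (@block_fill 9 4 _ s H Q (fun _ _ => 0) (fun _ _ => True)) => //.
    by lia.
  move=> v s' ltv fr _ _; split=> // a.
  set s1 := write_reg s' 9 v.
  have par1 : parameters 9 n m g s1.
    move=> r ltr; rewrite /= ifN; last by lia.
    by rewrite fr ?par // !inE; lia.
  have R6 : regs s1 6 = Q by rewrite par1.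
  have [_ mem] : True /\ forall a, memory (sem (CFor 13 6
    (CStore (Add (Add (Reg 8) (mul_const Q (Reg 9))) (Reg 13)) (Const 0))) s1) a =
    if H + Q * v <= a < H + Q * v + 1 * regs s1 6 then 0 else memory s1 a.
    apply: (@block_fill 13 6 _ s1 (H + Q * v) 1 (fun _ _ => 0) (fun _ _ => True)) => //.
    move=> k s2 ltk fr2 _ _; split=> // b.
    rewrite [sem _ _]/= eval_mul_const /= (fr2 8 isT) (fr2 9 isT) (par1 8 isT) /=.
    by rewrite !mul1n addnS ltnS -eqn_leq eq_sym -/M -/H.
  by rewrite mem R6 mul1n mulnS [Q + _]addnC addnA.
by move=> a; rewrite mem R4.
Qed.

Let G := graph h t Q A bit code g m lit.
Let X := modulator h t Q A g m.
Let output_word := encode_VC G (Posz (budget h t Q A g m)) X.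

Lemma nth_allpairs (T1 T2 : Type) (x1 : T1) (x2 : T2) (f : T1 -> T2 -> nat) s1 s2 i j :
  i < size s1 -> j < size s2 ->
  nth 0 [seq f x y | x <- s1, y <- s2] (i * size s2 + j) = f (nth x1 s1 i) (nth x2 s2 j).
Proof.
elim: s1 i => [//|x s1 IH] [|i] lti ltj /=.
  by rewrite nth_cat size_map ltj (nth_map x2).
by rewrite nth_cat size_map mulSn -addnA ltnNge leq_addr /= addKn IH.
Qed.

Lemma nth_output a : nth 0 output_word a =
  if a < 3 then nth 0 [:: M; 0; budget h t Q A g m] a
  else if a < 3 + M then (a - 3 < num_modulator h g : nat)
  else if a < H then nat_of_bool (adj h t Q A bit code g m lit
    ((a - (3 + M)) %/ M) ((a - (3 + M)) %% M))
  else 0.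
Proof.
have i0 : 'I_M := Ordinal M_gt0.
case: (ltnP a 3) => lea; first by case: a lea => [|[|[|//]]].
have -> : nth 0 output_word a = nth 0 ([seq nat_of_bool (i \in X) | i <- enum 'I_M]
    ++ [seq nat_of_bool (edge G i j) | i <- enum 'I_M, j <- enum 'I_M]) (a - 3).
  by rewrite -{1}(subnKC lea) /output_word /encode_VC.
rewrite nth_cat size_map size_enum_ord ltn_subLR // .
case: (ltnP a (3 + M)) => leaM.
  have lt : a - 3 < M by lia.
  by rewrite (nth_map i0) ?size_enum_ord // inE nth_enum_ord.
rewrite -subnDA.
have [lt|le] := ltnP a H; last first.
  by rewrite nth_default // size_allpairs !size_enum_ord; move: le; rewrite /H; lia.
have ltMM : a - (3 + M) < M * M by move: lt; rewrite /H; lia.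
have ltd : (a - (3 + M)) %/ M < M by rewrite ltn_divLR ?M_gt0.
have ltm : (a - (3 + M)) %% M < M by rewrite ltn_mod M_gt0.
have := @nth_allpairs _ _ i0 i0 (fun i j => nat_of_bool (edge G i j))
  (enum 'I_M) (enum 'I_M) ((a - (3 + M)) %/ M) ((a - (3 + M)) %% M).
by rewrite !size_enum_ord -divn_eq => -> //=; rewrite !nth_enum_ord.
Qed.

Lemma transformP s : parameters 9 n m g s -> memory s = nth 0 input_word ->
  memory (sem transform s) = nth 0 output_word.
Proof.
move=> par mem; apply/funext => a.
have [par1 tab1 out1] := load_tableP par mem.
have [par2 mem2] := write_prefixP par1.
have tab2 : table_loaded (sem write_prefix (sem load_table s)).
  move=> j k ltj ltk; have /andP[le _] := table_in ltj ltk.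
  by rewrite mem2 !ifN ?tab1 //; move: le; rewrite /H; lia.
have [par3 mem3] := write_matrixP par2 tab2.
rewrite /transform; cbn [sem]; rewrite clear_tableP // nth_output.
have le3 : 3 + M <= H by rewrite leq_addr.
case: ifP => [/andP[le _]|nin].
  by rewrite !ifN //; lia.
rewrite mem3; case: (ltnP a H) nin => /= [lt _|le nin].
  rewrite andbT leqNgt mem2; case: (ltnP a (3 + M)) => //= leMa.
  by case: (ltnP a 3) => //; lia.
rewrite andbF mem2 !ifN ?out1 //; try lia.
Qed.

Lemma clear_registersP s :
  (forall r, regs (sem clear_registers s) r = if r < 17 then 0 else regs s r) /\
  memory (sem clear_registers s) = memory s.
Proof. by split=> //; do 17 case=> [//|]. Qed.

Definition preprocessing := Seq (compile read_header) (Seq (compile set_sizes)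
  (Seq (compile set_table_address) (Seq (compile transform) (compile clear_registers)))).

Definition preprocessing_weight V := weight V read_header + (weight V set_sizes +
  (weight V set_table_address + (weight V transform + weight V clear_registers))).

Theorem preprocessingP V L : g = num_groups t n ->
  sumn (parameter_values n m g) <= V -> bounded L (init input_word) ->
  runs preprocessing (init input_word) (init output_word) L (preprocessing_weight V).
Proof.
move=> Eg leV b0.
have [w1 w2 w3 w4 w5] := program_well_formed.
have leV' r : nth 0 (parameter_values n m g) r <= V.
  apply: leq_trans leV; have [lt|ge] := ltnP r (size (parameter_values n m g)).
    by rewrite sumnE (big_nth 0) big_mkord (bigD1 (Ordinal lt)) //= leq_addr.
  by rewrite nth_default.
set s0 := init input_word in b0 *.
set s1 := sem read_header s0; set s2 := sem set_sizes s1.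
set s3 := sem set_table_address s2; set s4 := sem transform s3.
have [par2 mem2] : parameters 8 n m g s2 /\ memory s2 = memory s1.
  by rewrite Eg; apply: set_sizesP.
have [par3 mem3] := set_table_addressP par2.
have mem4 : memory s4 = nth 0 output_word.
  by apply: transformP => //; rewrite mem3 mem2.
have [regs5 mem5] := clear_registersP s4.
have E5 : init output_word = sem clear_registers s4.
  rewrite /init -mem4 -mem5.
  have -> : (fun=> 0) = regs (sem clear_registers s4).
    apply/funext => r; rewrite regs5; case: ltnP => // ler.
    rewrite /s4 /s3 /s2 /s1 !sem_regs //; rewrite !inE; lia.
  by case: (sem _ _).
have x1 := @exec_compile 0 V _ s0 L w1 (fun _ => ltac:(by [])) b0.
have b1 : bounded (L + weight V read_header) s1 by case: x1 => ? [].
have fr1 r : r < 2 -> regs s1 r <= V.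
  by case: r => [|[|//]] _; [apply: (leV' 0)|apply: (leV' 1)].
have x2 := @exec_compile 2 V _ s1 _ w2 fr1 b1.
have b2 := let: ex_intro _ (And3 _ b _) := x2 in b.
have fr2 r : r < 8 -> regs s2 r <= V by move=> lt; rewrite par2.
have x3 := @exec_compile 8 V _ s2 _ w3 fr2 b2.
have b3 := let: ex_intro _ (And3 _ b _) := x3 in b.
have fr3 r : r < 9 -> regs s3 r <= V by move=> lt; rewrite par3.
have x4 := @exec_compile 9 V _ s3 _ w4 fr3 b3.
have b4 := let: ex_intro _ (And3 _ b _) := x4 in b.
have x5 := @exec_compile 0 V _ s4 _ w5 (fun _ => ltac:(by [])) b4.
rewrite E5.
exact: runs_seq x1 (runs_seq x2 (runs_seq x3 (runs_seq x4 x5))).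
Qed.

End Transform.

End Program.

(** * Formulas as tables of literals *)

Definition clause_codes n (phi : seq (seq ('I_n * bool))) : seq (seq nat) :=
  [seq [seq encode_literal l | l <- C] | C <- phi].

Lemma input_word_CNF n (phi : seq (seq ('I_n * bool))) :
  input_word n (clause_codes phi) = encode_CNF phi.
Proof.
rewrite /input_word /encode_CNF size_map; congr [:: _, _ & flatten _].
by rewrite -map_comp; apply: eq_map => C; rewrite /= /encode_clause size_map.
Qed.

Lemma clause_codes_size q n (phi : seq (seq ('I_n * bool))) j :
  is_qCNF q phi -> size (nth [::] (clause_codes phi) j) <= q.
Proof.
move=> /andP[_ /allP sz]; have [lt|ge] := ltnP j (size phi); last first.
  by rewrite nth_default ?size_map.
by rewrite (nth_map [::]) // size_map sz // mem_nth.
Qed.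

Lemma lit_codes n (phi : seq (seq ('I_n * bool))) j k l0 :
  j < size phi -> k < size (nth [::] phi j) ->
  lit (clause_codes phi) j k = (encode_literal (nth l0 (nth [::] phi j) k)).+1.
Proof.
move=> ltj ltk; rewrite /lit size_map ltj (nth_map [::]) // size_map ltk.
by rewrite (nth_map l0).
Qed.

Lemma lit_none n (phi : seq (seq ('I_n * bool))) j k :
  j < size phi -> size (nth [::] phi j) <= k -> lit (clause_codes phi) j k = 0.
Proof.
move=> ltj lek; rewrite /lit size_map ltj (nth_map [::]) // size_map.
by rewrite ltnNge lek.
Qed.

Lemma lit_tautology n (phi : seq (seq ('I_n * bool))) v :
  lit (clause_codes phi) (size (clause_codes phi) + v) 0 = 2 * v + 2 /\
  forall k, 0 < k -> lit (clause_codes phi) (size (clause_codes phi) + v) k =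
    if k == 1 then 2 * v + 1 else 0.
Proof. by rewrite /lit ltnNge leq_addr /= addKn; split=> // -[]. Qed.

Lemma encode_literalK n (l : 'I_n * bool) :
  (encode_literal l)./2 = l.1 /\ odd (encode_literal l) = l.2.
Proof.
by rewrite /encode_literal addnC half_bit_double oddD odd_double addbF oddb.
Qed.

Lemma satisfiableP q Q n (phi : seq (seq ('I_n * bool))) :
  is_qCNF q phi -> q <= Q ->
  satisfiable phi <->
  exists f, forall j, j < size (clause_codes phi) ->
    satisfied Q (lit (clause_codes phi)) f j.
Proof.
move=> cnf leq; rewrite size_map; split=> [[v /allP sat]|[f sat]].
  exists (fun x => if insub x is Some i then v i else false) => j ltj.
  have /hasP[l lin vl] := sat _ (mem_nth [::] ltj).
  have ltk : index l (nth [::] phi j) < size (nth [::] phi j) by rewrite index_mem.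
  apply/hasP; exists (index l (nth [::] phi j)).
    rewrite mem_iota; apply: leq_trans leq; apply: leq_trans ltk _.
    by have := clause_codes_size j cnf; rewrite (nth_map [::]) // size_map.
  rewrite (lit_codes l) // nth_index //=.
  by have [-> ->] := encode_literalK l; rewrite valK.
exists (fun i => f i); apply/allP => C Cin.
have ltj : index C phi < size phi by rewrite index_mem.
have /hasP[k _ /andP[l0 fl]] := sat _ ltj.
have [ltk|lek] := ltnP k (size C); last by rewrite lit_none ?nth_index in l0.
case: C Cin ltj l0 fl ltk => // l C Cin ltj l0 fl ltk.
rewrite (lit_codes l) ?nth_index // in fl.
apply/hasP; exists (nth l (l :: C) k); first exact: mem_nth.
by move: fl; rewrite succnK; have [-> ->] := encode_literalK (nth l (l :: C) k).
Qed.

Lemma lit_variable q Q n (phi : seq (seq ('I_n * bool))) t g j k :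
  is_qCNF q phi -> n <= t * g ->
  j < num_clauses t g (size (clause_codes phi)) -> k < Q ->
  lit (clause_codes phi) j k != 0 -> (lit (clause_codes phi) j k).-1./2 < t * g.
Proof.
move=> cnf len ltj _ l0.
have [ltm|lem] := ltnP j (size phi).
  have [ltk|lek] := ltnP k (size (nth [::] phi j)); last by rewrite lit_none in l0.
  case E : (nth [::] phi j) ltk => [//|l C] ltk.
  rewrite (lit_codes l) ?E // succnK.
  by have [-> _] := encode_literalK (nth l (l :: C) k); apply: leq_trans len.
have sz : size (clause_codes phi) = size phi by rewrite size_map.
rewrite /num_clauses sz in ltj.
have [T0 T1] := lit_tautology phi (j - size phi).
rewrite sz subnKC // in T0 T1.
case: k l0 => [|k] l0; first by rewrite T0; lia.
by rewrite T1 // in l0 *; case: (k.+1 == 1) l0; lia.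
Qed.

(** Padded to length [q], distinct clauses stay distinct, and each position has [2 * n + 1] possible
    contents. This bounds the input length polynomially in [n]. *)
Lemma size_qCNF q n (phi : seq (seq ('I_n * bool))) :
  is_qCNF q phi -> size phi <= (2 * n).+1 ^ q.
Proof.
move=> /andP[uphi /allP sz].
pose F (C : seq ('I_n * bool)) : {ffun 'I_q -> option ('I_n * bool)} :=
  [ffun i : 'I_q => onth C i].
have injF : {in phi &, injective F}.
  move=> C1 C2 /sz s1 /sz s2 /ffunP E.
  have Ek k : onth C1 k = onth C2 k.
    have [ltk|lek] := ltnP k q; first by have := E (Ordinal ltk); rewrite !ffunE.
    by rewrite !onth_default ?(leq_trans s1) ?(leq_trans s2).
  elim: C1 C2 Ek {s1 s2 E} => [|x C1 IH] [|y C2] Ek //.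
  - by have := Ek 0.
  - by have := Ek 0.
  by have [->] := Ek 0; congr cons; apply: IH => k; apply: (Ek k.+1).
have -> : (2 * n).+1 ^ q = #|{ffun 'I_q -> option ('I_n * bool)}|.
  by rewrite card_ffun card_option card_prod card_bool !card_ord mulnC.
rewrite -(size_map F) -(card_uniqP _) ?max_card //.
by rewrite map_inj_in_uniq.
Qed.

(** Any injection of the functions on [t] points into the [w]-subsets will do, so both sides are
    enumerated and matched by index. *)
Lemma coding_exists t p w : 2 ^ t <= 'C(p, w) ->
  exists A (bit code : nat -> nat -> bool),
  [/\ forall f : nat -> bool, exists2 a, a < A & forall r, r < t -> bit a r = f r,
      forall a, a < A -> \sum_(0 <= e < p) code a e = w &
      forall a a', a < A -> a' < A ->
        (forall e, e < p -> code a e = code a' e) ->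
        forall r, r < t -> bit a r = bit a' r].
Proof.
move=> le; pose D := [set S : {set 'I_p} | #|S| == w].
have cD : #|D| = 'C(p, w) by rewrite card_draws card_ord.
pose K := {ffun 'I_t -> bool}.
have cK : #|{: K}| = 2 ^ t by rewrite card_ffun card_bool card_ord.
pose bit a r := match insub a : option 'I_#|{: K}|, insub r : option 'I_t with
  | Some i, Some r => (enum_val i : K) r | _, _ => false end.
pose code a e := if insub e is Some e' then e' \in nth finset.set0 (enum D) a else false.
have szD a : a < #|{: K}| -> a < size (enum D).
  by move=> lt; rewrite -cardE cD; apply: leq_trans lt _; rewrite cK.
exists #|{: K}|, bit, code; split.
- move=> f; pose k : K := [ffun r : 'I_t => f r].
  exists (enum_rank k) => // r ltr.
  by rewrite /bit valK insubT enum_rankK ffunE.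
- move=> a lta; set S := nth finset.set0 (enum D) a.
  have : S \in D by rewrite -mem_enum mem_nth // szD.
  rewrite inE => /eqP <-; rewrite big_mkord -sum1_card [RHS]big_mkcond.
  by apply: eq_bigr => e _; rewrite /code valK -/S; case: (e \in S).
- move=> a a' lta lta' E; suff -> : a = a' by [].
  apply/eqP; rewrite -(nth_uniq finset.set0 (szD _ lta) (szD _ lta') (enum_uniq _)).
  by apply/eqP/setP => e; have := E _ (ltn_ord e); rewrite /code valK.
Qed.

(** * The reduction *)

(** The positive base [n.+1] makes the bound monotone in [d], also at [n = 0]. *)
Definition poly_bounded (f : nat -> nat) := exists a d, forall n, f n <= a * n.+1 ^ d.

Lemma poly_boundedW f1 f2 : (forall n, f1 n <= f2 n) -> poly_bounded f2 -> poly_bounded f1.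
Proof. by move=> le [a [d H]]; exists a, d => n; apply: leq_trans (le n) (H n). Qed.

Lemma poly_bounded_const c : poly_bounded (fun=> c).
Proof. by exists c, 0 => n; rewrite muln1. Qed.

Lemma poly_bounded_id : poly_bounded id.
Proof. by exists 1, 1 => n; rewrite mul1n expn1. Qed.

Lemma poly_boundedD f1 f2 :
  poly_bounded f1 -> poly_bounded f2 -> poly_bounded (fun n => f1 n + f2 n).
Proof.
move=> [a1 [d1 H1]] [a2 [d2 H2]]; exists (a1 + a2), (d1 + d2) => n; rewrite mulnDl.
by apply: leq_add; [apply: leq_trans (H1 n) _ | apply: leq_trans (H2 n) _];
  rewrite leq_mul // leq_pexp2l // ?leq_addr ?leq_addl.
Qed.

Lemma poly_boundedM f1 f2 :
  poly_bounded f1 -> poly_bounded f2 -> poly_bounded (fun n => f1 n * f2 n).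
Proof.
move=> [a1 [d1 H1]] [a2 [d2 H2]]; exists (a1 * a2), (d1 + d2) => n.
by rewrite expnD mulnACA leq_mul.
Qed.

Lemma poly_boundedX f k : poly_bounded f -> poly_bounded (fun n => f n ^ k).
Proof.
move=> pf; elim: k => [|k IH]; first by exists 1, 0 => n; rewrite expn0.
by apply: (poly_boundedW (f2 := fun n => f n * f n ^ k)); [move=> n; rewrite expnS
  | apply: poly_boundedM].
Qed.

Lemma poly_bounded_weight h t Q A bit code f :
  poly_bounded f -> poly_bounded (fun n => preprocessing_weight h t Q A bit code (f n)).
Proof.
move=> pf; have W c : poly_bounded (fun n => weight (f n) c).
  have [a [d H]] := weight_poly c.
  apply: (poly_boundedW (f2 := fun n => a * (f n + 1) ^ d)).
    by move=> n; rewrite addn1.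
  apply: poly_boundedM; first exact: poly_bounded_const.
  by apply: poly_boundedX; apply: poly_boundedD => //; apply: poly_bounded_const.
by do 4 (apply: poly_boundedD => //).
Qed.

Lemma input_size_le K w : (forall x, x \in w -> bitlen x <= K) -> input_size w <= size w * K.
Proof.
rewrite /input_size; elim: w => [|x w IH] le; first by rewrite big_nil.
rewrite big_cons /= mulSn leq_add ?le ?mem_head //.
by apply: IH => y yw; apply: le; rewrite inE yw orbT.
Qed.

Theorem reduction h t q : 0 < h -> h < t -> 2 ^ t <= 'C(2 * h, h) ->
  exists (P : program) (T : nat -> nat), poly_bounded T /\
  forall n (phi : seq (seq ('I_n * bool))), is_qCNF q phi ->
  exists (N : nat) (G : sgraph 'I_N) (b : int) (X : {set 'I_N}),
  [/\ pathwidth (delete G X) <= 2,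
      has_vertex_cover G b <-> satisfiable phi,
      t * #|X| <= 2 * h * (n + 2 * t),
      input_size (encode_VC G b X) <= T n &
      exists2 t0, t0 <= T n &
        exec P (init (encode_CNF phi)) t0 (init (encode_VC G b X))].
Proof.
move=> h0 hlt le2; have t0 : 0 < t by apply: leq_ltn_trans hlt.
have [A [bit [code [bsurj cw cinj]]]] := coding_exists le2.
have A0 : 0 < A by have [a lta _] := bsurj (fun=> true); apply: leq_ltn_trans lta.
(* The tautologies need two positions even if [q < 2]. *)
pose Q := maxn q 2.
have Q1 : 1 < Q by rewrite /Q leq_maxr.
have leqQ : q <= Q by rewrite /Q leq_maxl.
pose mu n := (2 * n).+1 ^ q.
(* The actual numbers of clauses and groups are replaced by the upper bounds [mu n] and [n + 2]. *)
pose V n := sumn (parameter_values h t Q A n (mu n) (n + 2)).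
(* At least every number in the input: [n], the number of clauses, the clause sizes, and literal
   codes, which are below [2 * n]. *)
pose L n := 3 * n + mu n + q.
pose W n := preprocessing_weight h t Q A bit code (V n).
(* The first summand bounds the running time, the second the output: at most [V n] cells of
   [L n + W n + 1] bits. *)
pose T n := 2 * (W n * (L n + W n + 1)) + V n * (L n + W n + 1).
have pmu : poly_bounded mu.
  apply: poly_boundedX; apply: (poly_boundedW (f2 := fun n => 2 * n + 1)).
    by move=> n; rewrite addn1.
  by apply: poly_boundedD (poly_bounded_const _); apply: poly_boundedM poly_bounded_id;
    apply: poly_bounded_const.
have pM : poly_bounded (fun n => num_vertices h t Q A (n + 2) (mu n)).
  rewrite /num_vertices /num_modulator /num_clauses.
  repeat first [exact: pmu | exact: poly_bounded_const | exact: poly_bounded_id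
     | apply: poly_boundedD | apply: poly_boundedM].
have pV : poly_bounded V.
  rewrite /V /parameter_values /= /num_modulator.
  repeat first [exact: pM | exact: pmu | exact: poly_bounded_const | exact: poly_bounded_id
     | apply: poly_boundedD | apply: poly_boundedM].
have pL : poly_bounded L.
  repeat first [exact: pmu | exact: poly_bounded_const | exact: poly_bounded_id
     | apply: poly_boundedD | apply: poly_boundedM].
have pW : poly_bounded W by apply: poly_bounded_weight.
have pT : poly_bounded T.
  repeat first [exact: pL | exact: pV | exact: pW | exact: poly_bounded_const
     | apply: poly_boundedD | apply: poly_boundedM].
exists (preprocessing h t Q A bit code), T; split=> // n phi cnf.
set cl := clause_codes phi; set g := num_groups t n.
have g0 : 0 < g := num_groups_gt0 t n.
have leg : g <= n + 2.
  have := num_groups_le t n; rewrite -/g => lg.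
  rewrite -(leq_pmul2l t0); apply: leq_trans lg _.
  by rewrite mulnDr [2 * t]mulnC leq_add2r leq_pmull.
have szm : size cl <= mu n by rewrite size_map; apply: size_qCNF.
have szq j : size (nth [::] cl j) <= Q.
  by apply: leq_trans leqQ; apply: clause_codes_size.
set m := size cl in szm.
pose N := num_vertices h t Q A g m.
have leN : N <= num_vertices h t Q A (n + 2) (mu n).
  by rewrite leq_add ?leq_mul // leq_add // leq_mul.
have leV : sumn (parameter_values h t Q A n m g) <= V n.
  have le1 : t * g <= t * (n + 2) by rewrite leq_mul.
  rewrite /V /=; repeat apply: leq_add => //.
  - by rewrite leq_mul.
  - exact: leq_mul.
have bL : bounded (L n) (init (encode_CNF phi)).
  split=> [r|a] /=; first by rewrite expn_gt0.
  have lt x : x <= L n -> x < 2 ^ L n.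
    by move=> lex; apply: leq_ltn_trans lex _; apply: ltn_expl.
  apply: lt; case: (ltnP a (size (encode_CNF phi))) => [lta|gea]; last first.
    by rewrite nth_default.
  have := mem_nth 0 lta; move: (nth _ _ _) => x; rewrite /encode_CNF !inE => /or3P[].
  - by move/eqP->; rewrite /L; lia.
  - by move/eqP->; move: szm; rewrite /m size_map /L; lia.
  - move=> /flattenP[w /mapP[C Cin ->]]; rewrite inE => /orP[/eqP ->|/mapP[l _ ->]].
      by case/andP: cnf => _ /allP /(_ C Cin); rewrite /L; lia.
    have := ltn_ord l.1; rewrite /encode_literal /L; case: (l.2) => /=; lia.
rewrite -input_word_CNF -/cl in bL *.
have [t1 [x1 b1 l1]] := preprocessingP bit code h0 t0 A0 Q1 g0 szq erefl leV bL.
set G := graph _ _ _ _ _ _ _ _ _ in x1 b1; set X := modulator _ _ _ _ _ _ in x1 b1.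
exists N, G, (Posz (budget h t Q A g m)), X; split.
- exact: pathwidth_graph.
- rewrite (satisfiableP cnf leqQ); apply: vertex_coverP => //.
    by move=> j k ltj ltk l0; apply: (lit_variable cnf _ ltj ltk l0); apply: num_groups_ge.
  by move=> v _; apply: lit_tautology.
- by rewrite card_modulator /num_modulator mulnCA leq_mul // num_groups_le.
- have bb x : x \in encode_VC G (Posz (budget h t Q A g m)) X -> bitlen x <= L n + W n + 1.
    move=> xin; rewrite addn1; apply: bitlen_bound.
    by case: b1 => _ /(_ (index x (encode_VC G (budget h t Q A g m) X))) /=; rewrite nth_index.
  apply: leq_trans (input_size_le bb) _; rewrite /T; apply: leq_trans (leq_addl _ _).
  rewrite leq_mul2r; apply/orP; right; apply: leq_trans leV.
  rewrite /encode_VC /= size_cat size_map size_allpairs !size_enum_ord -/N /=; lia.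
- exists t1 => //; apply: leq_trans l1 _.
  by rewrite /T addn1 leq_addr.
Qed.

(** * Exponents *)

(** Consecutive central binomials have ratio [2 * (2 * h + 1) / (h + 1)], and multiplied by
    [(2 * h + 3) / (2 * h + 1)] this is at least 4. *)
Lemma central_binomial_lb h : 4 ^ h <= (2 * h).+1 * 'C(2 * h, h).
Proof.
elim: h => [//|h IH].
have E1 := mul_bin_diag (2 * h).+2 h; rewrite [(2 * h).+2.-1]/= in E1.
have E2 := mul_bin_diag (2 * h).+1 h; rewrite [(2 * h).+1.-1]/= in E2.
have E3 : 'C((2 * h).+1, h.+1) = 'C((2 * h).+1, h).
  by rewrite -bin_sub; [congr 'C(_, _)|]; lia.
rewrite E3 in E2; have -> : 2 * h.+1 = (2 * h).+2 by lia.
rewrite expnS; move: IH E1 E2; set x := 'C(_, _); set y := 'C(_, h); set z := 'C(_, _).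
move: (4 ^ h) => u; nia.
Qed.

(** Taking [h = 2 ^ k] avoids logarithms: the factor [2 * h + 1] is at most [2 ^ (k + 2)]. *)
Lemma many_balanced_sets k : 2 ^ (2 * 2 ^ k - (k + 2)) <= 'C(2 * 2 ^ k, 2 ^ k).
Proof.
have lek : k + 2 <= 2 * 2 ^ k by elim: k => // k IH; rewrite expnS; lia.
have := central_binomial_lb (2 ^ k).
have -> : 4 ^ (2 ^ k) = 2 ^ (2 * 2 ^ k) by rewrite expnM.
rewrite -{1}(subnK lek) expnD => le.
rewrite -(leq_pmul2r (expn_gt0 2 (k + 2))) .
apply: leq_trans le _; rewrite mulnC leq_mul2l; apply/orP; right.
by rewrite addn2 !expnS; have := expn_gt0 2 k; lia.
Qed.

Lemma exp2_beats_linear a : exists2 k, 3 <= k & a * (k + 2) <= 2 * 2 ^ k.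
Proof.
(* This choice makes [2 * 2 ^ k] the square of [2 ^ (2 * a + 2)], hence at least the square of
   [2 * a + 3]. *)
exists (4 * a + 3); first by lia.
have -> : 2 * 2 ^ (4 * a + 3) = (2 ^ (2 * a + 2)) ^ 2.
  by rewrite -expnS -expnM; congr (2 ^ _); lia.
have le := ltn_expl (2 * a + 2) (isT : 1 < 2).
apply: leq_trans (_ : (2 * a + 3) ^ 2 <= _); last by rewrite leq_sqr; lia.
by rewrite expnS expn1; nia.
Qed.

Local Open Scope ring_scope.

Section Analysis.
Variable R : realType.

Lemma powR2E (x : R) : 2 `^ x = expR (x * ln 2).
Proof. by rewrite /powR pnatr_eq0. Qed.

Lemma ln2_gt0 : 0 < ln 2 :> R.
Proof. by apply: ln_gt0; rewrite ltr1n. Qed.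

(** From [n + 1 <= B * (1 + theta * n) <= B * expR (theta * n)] by taking [D]-th powers; the
    denominator [D.+1] of [theta] covers [D = 0]. *)
Lemma poly_le_exp (D : nat) (eta : R) : 0 < eta ->
  exists2 C : R, 0 <= C & forall n : nat, n.+1%:R ^+ D <= C * 2 `^ (eta * n%:R).
Proof.
move=> eta0; pose theta : R := eta * ln 2 / D.+1%:R.
have theta0 : 0 < theta by rewrite divr_gt0 ?mulr_gt0 ?ln2_gt0 ?ltr0n.
pose B : R := 1 + theta^-1.
have B0 : 0 <= B by rewrite addr_ge0 // invr_ge0 ltW.
exists (B ^+ D); first exact: exprn_ge0.
move=> n; have le1 : n.+1%:R <= B * expR (theta * n%:R).
  apply: le_trans (_ : B * (1 + theta * n%:R) <= _); last first.
    by rewrite ler_wpM2l ?expR_ge1Dx.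
  rewrite /B mulrDl mul1r [theta^-1 * _]mulrDr mulr1 mulrA mulVf ?gt_eqF // mul1r.
  have : 0 <= theta * n%:R by rewrite mulr_ge0 // ltW.
  have : 0 <= theta^-1 by rewrite invr_ge0 ltW.
  rewrite -natr1; lra.
apply: le_trans (_ : (B * expR (theta * n%:R)) ^+ D <= _).
  by rewrite lerXn2r // nnegrE ?ler0n // mulr_ge0 // expR_ge0.
rewrite exprMn ler_wpM2l ?exprn_ge0 // -expRM_natl powR2E ler_expR.
rewrite mulrA [leRHS]mulrAC ler_wpM2r // /theta mulrCA -[leRHS]mulr1.
rewrite ler_wpM2l //; first by rewrite ltW // mulr_gt0 // ln2_gt0.
by rewrite ler_pdivrMr ?ltr0n // mul1r ler_nat.
Qed.

(* An instance with [|X| = 1] would have to be solved in negative time. *)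
Lemma base_ge0 (A : program) (beta : R) : solves_VC_pw2_modulator A beta -> 0 <= beta.
Proof.
move=> [c [d sol]]; rewrite leNgt; apply/negP => lt0.
pose G := @SGraph 'I_1 (fun _ _ => false) (fun _ _ => erefl) (fun _ => erefl).
have pw : (pathwidth (delete G [set: 'I_1]) <= 2)%N.
  apply: (@pathwidth_le2 _ _ (fun=> 0%N)) => // x.
  by have := valP x; rewrite !inE.
have [t [s' [x le _]]] := sol 1%N G 0 _ pw.
have := exec_time_gt0 x; rewrite -(ltr0n R) ltNge => /negP; apply.
apply: le_trans le _; rewrite cardsT card_ord expr1.
by rewrite mulr_ge0_le0 ?mulr_ge0 ?exprn_ge0 // ltW.
Qed.

Lemma vc_exponent (beta : R) : 0 <= beta < 2 ->
  exists2 sigma : R, 0 <= sigma < 1 & forall k, beta ^+ k <= 2 `^ (sigma * k%:R).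
Proof.
(* The maximum with 1 keeps the logarithm nonnegative when [beta] is small or 0. *)
move=> /andP[b0 b2]; pose b := Num.max 1 beta.
have b1 : 1 <= b by rewrite le_max lexx.
have bpos : 0 < b by apply: lt_le_trans b1.
exists (ln b / ln 2).
  rewrite divr_ge0 ?ln_ge0 ?ler1n //= ltr_pdivrMr ?ln2_gt0 // mul1r.
  by rewrite ltr_ln ?posrE // gt_max b2 ltr1n.
move=> k; apply: le_trans (_ : b ^+ k <= _).
  by rewrite lerXn2r ?nnegrE // ?(ltW bpos) // le_max lexx orbT.
rewrite powR2E mulrAC divfK ?gt_eqF ?ln2_gt0 //.
by rewrite mulrC expRM_natl lnK ?posrE.
Qed.

(** With [t = 2 * h - (k + 2)], the claim amounts to [delta * (k + 2) <= (delta - sigma) * (2 * h)].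
    It holds once [2 * h] exceeds [k + 2] by a factor [a] of at least the inverse of
    [delta - sigma]. *)
Lemma group_parameters (sigma delta : R) : 0 <= sigma < delta -> delta <= 1 ->
  exists h t : nat, [/\ (0 < h)%N, (h < t)%N, (2 ^ t <= 'C(2 * h, h))%N &
    sigma * (2 * h)%:R <= delta * t%:R].
Proof.
move=> /andP[s0 sd] d1; pose a := (Num.truncn (delta - sigma)^-1).+1.
have [k k3 lek] := exp2_beats_linear a.
have le2 : (2 * k < 2 ^ k)%N.
  elim: k k3 {lek} => // k IH; rewrite leq_eqVlt => /orP[/eqP <- //|lt2k].
  by have := IH lt2k; rewrite expnS; lia.
exists (2 ^ k)%N, (2 * 2 ^ k - (k + 2))%N; split; rewrite ?expn_gt0 ?many_balanced_sets //.
  by lia.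
rewrite natrB; last by lia.
set H := (2 * 2 ^ k)%:R; set K := (k + 2)%:R.
have K0 : 0 <= K :> R by rewrite ler0n.
have leK : a%:R * K <= H by rewrite -natrM ler_nat.
have a1 : 1 <= (delta - sigma) * a%:R.
  by rewrite -ler_pdivrMl ?subr_gt0 // mulr1 ltW // truncnS_gt.
have : K <= (delta - sigma) * H.
  apply: le_trans (_ : (delta - sigma) * (a%:R * K) <= _).
    by rewrite mulrA ler_peMl.
  by rewrite ler_wpM2l // subr_ge0 ltW.
have : delta * K <= K by rewrite ler_piMl.
rewrite mulrBl mulrBr; lra.
Qed.

End Analysis.


(** In [sigma < delta1 < delta < 1], the first gap pays for the ratio [2 * h / t], and the second
    absorbs the polynomial factors. Both are fixed before [q]. *)
Theorem qSAT_solvable_of_VC (R : realType) (A : program) (beta : R) :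
  0 <= beta < 2 -> solves_VC_pw2_modulator A beta ->
  exists2 delta : R, delta < 1 & forall q, qSAT_solvable q delta.
Proof.
move=> b02 [c [d sol]].
have [sigma /andP[s0 s1] bound] := vc_exponent b02.
pose delta1 : R := (1 + sigma) / 2; pose delta : R := (1 + delta1) / 2.
have sd1 : sigma < delta1 by rewrite /delta1; lra.
have d11 : delta1 < 1 by rewrite /delta1; lra.
have d10 : 0 <= delta1 by rewrite /delta1; lra.
have dd : 0 < delta - delta1 by rewrite /delta; lra.
exists delta; first by rewrite /delta; lra.
move=> q.
have [|h [t [h0 hlt le2 leht]]] := @group_parameters R sigma delta1 _ (ltW d11).
  by rewrite s0.
have [P [T [pT red]]] := reduction q h0 hlt le2.
have t0 : (0 < t)%N by apply: leq_ltn_trans hlt.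
have [a [D polyT]] : poly_bounded (fun n => T n + c * T n ^ d)%N.
  by apply: poly_boundedD => //; apply: poly_boundedM (poly_bounded_const c) _;
    apply: poly_boundedX.
have [C C0 expC] := @poly_le_exp R D _ dd.
(* The price of the at most [2 * t] variables added by rounding up to groups. *)
pose K : R := 2 `^ (delta1 * (2 * t)%:R).
have K0 : 0 <= K by rewrite powR_ge0.
exists (Seq P A), (Num.truncn (a%:R * C * K)).+1 => n phi cnf.
have [N [G [b [X [pw vc card size [t1 let1 x1]]]]]] := red n phi cnf.
have [t2 [s' [x2 let2 ans]]] := sol N G b X pw.
exists (t1 + t2)%N, s'; split; [exact: ExecSeq x1 x2 | | by rewrite ans vc].
pose E : R := 2 `^ (delta1 * (n + 2 * t)%:R).
have E1 : 1 <= E.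
  rewrite /E powR2E -[leLHS]expR0 ler_expR; apply: mulr_ge0; first exact: mulr_ge0.
  exact: ltW (ln2_gt0 R).
have leX : beta ^+ #|X| <= E.
  apply: le_trans (bound _) _; rewrite /E ler_powR ?ler1n //.
  have tR : 0 < t%:R :> R by rewrite ltr0n.
  rewrite -(ler_pM2l tR) mulrCA -natrM [leRHS]mulrA [t%:R * delta1]mulrC.
  apply: le_trans (_ : sigma * (2 * h * (n + 2 * t))%:R <= _).
    by rewrite ler_wpM2l // ler_nat.
  by rewrite natrM mulrA ler_wpM2r.
have le2' : t2%:R <= c%:R * (T n)%:R ^+ d * E.
  apply: le_trans let2 _; apply: ler_pM => //.
  - by rewrite exprn_ge0 //; case/andP: b02.
  - by rewrite ler_wpM2l // lerXn2r ?nnegrE // ler_nat.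
have tot : (t1 + t2)%:R <= (T n + c * T n ^ d)%:R * E.
  rewrite !natrD natrM natrX mulrDl lerD //.
  by apply: le_trans (_ : (T n)%:R <= _); rewrite ?ler_nat // ler_peMr.
apply: le_trans tot _.
have EK : E = 2 `^ (delta1 * n%:R) * K.
  by rewrite /E /K natrD mulrDr !powR2E mulrDl expRD.
have Ed : 2 `^ (delta * n%:R) = 2 `^ ((delta - delta1) * n%:R) * 2 `^ (delta1 * n%:R) :> R.
  by rewrite !powR2E -expRD -!mulrDl subrK.
have p1 : (T n + c * T n ^ d)%:R <= a%:R * (C * 2 `^ ((delta - delta1) * n%:R)).
  apply: le_trans (_ : a%:R * n.+1%:R ^+ D <= _).
    by rewrite -natrX -natrM ler_nat.
  by rewrite ler_wpM2l.
apply: le_trans (_ : a%:R * C * K * 2 `^ (delta * n%:R) <= _); last first.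
  by rewrite ler_wpM2r ?powR_ge0 // ltW // truncnS_gt.
apply: le_trans (_ : a%:R * (C * 2 `^ ((delta - delta1) * n%:R)) * E <= _).
  by rewrite ler_wpM2r // (le_trans ler01 E1).
rewrite EK Ed le_eqVlt; apply/orP; left; apply/eqP.
set x := _ `^ _; set y := _ `^ _.
by rewrite -!mulrA; congr (_ * (_ * _)); rewrite [RHS]mulrC -mulrA.
Qed.

Theorem theorem7p1 (R : realType) :
  (exists2 eps : R, 0 < eps &
     exists A : program, solves_VC_pw2_modulator A (2 - eps)) ->
  ~ SETH R.
Proof.
move=> [eps eps0 [A sol]] seth.
have b02 : 0 <= 2 - eps < 2.
  by rewrite (base_ge0 sol) /=; lra.
have [delta d1 qs] := qSAT_solvable_of_VC b02 sol.
(* All exponents lie below the same [delta], hence so does their limit, which SETH says is 1. *)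
have : ((1 : R)%:E <= delta%:E)%E.
  apply: (cvge_le _ seth); apply: nearW => q.
  by apply: ereal_inf_lbound; exists delta; first exact: qs.
by rewrite lee_fin leNgt d1.
Qed.
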